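(* Let $\varphi(z)=1+B_1z+B_2z^2+B_3z^3+\cdots$ be a Ma–Minda function and let $f\in\mathcal{C}(\varphi)$. Then the following hold. (1) $1-\dfrac{B_1^2}{4}\le \det T_{2,1}(f)\le 1$. (2) If $B_1\le |B_2+B_1^2|$, then $\det T_{3,1}(f)\le 1$. All these estimates are sharp.
   Context: $\mathbb{D}=\{z\in\mathbb{C}:|z|<1\}$. $\mathcal{A}$ is the class of analytic functions $f(z)=z+a_2z^2+a_3z^3+\cdots$ on $\mathbb{D}$. A Ma–Minda function is an analytic univalent function $\varphi$ on $\mathbb{D}$ with positive real part, $\varphi(0)=1$, $\varphi'(0)>0$, such that $\varphi(\mathbb{D})$ is starlike with respect to $1$ and symmetric about the real axis (so the coefficients $B_n$ are real and $B_1>0$). $\mathcal{C}(\varphi)=\{f\in\mathcal{A}: 1+zf''(z)/f'(z)\prec\varphi(z)\}$, where $\prec$ denotes subordination: $h\prec\varphi$ means $h=\varphi\circ\omega$ for some analytic $\omega:\mathbb{D}\to\mathbb{D}$ with $\omega(0)=0$. For $f(z)=z+a_2z^2+a_3z^3+\cdots$, the second and third order Hermitian–Toeplitz determinants are $$\det T_{2,1}(f)=1-|a_2|^2,\qquad \det T_{3,1}(f)=\begin{vmatrix}1&a_2&a_3\\ \bar a_2&1&a_2\\ \bar a_3&\bar a_2&1\end{vmatrix}=2\,\mathrm{Re}(a_2^2\bar a_3)-2|a_2|^2-|a_3|^2+1.$$ An estimate is sharp if, for each $\varphi$ satisfying its hypotheses, equality is attained by some function in the class. *)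

(* Defs.v *)
From Stdlib Require Import Reals Lra.
From Coquelicot Require Import Coquelicot.

Open Scope R_scope.
Open Scope C_scope.

Definition unit_disk (z : C) : Prop := Cmod z < 1.

Definition analytic_on_disk (f : C -> C) : Prop :=
  forall z : C, unit_disk z -> ex_derive f z.

(** [a n] is the coefficient of [z^n] in the Taylor expansion of [f] at [0].
    The coefficients are determined by [f], and every [f] analytic on the disk
    has such an expansion. *)
Definition has_expansion (f : C -> C) (a : nat -> C) : Prop :=
  forall z : C, unit_disk z -> is_pseries a z (f z).

Definition class_A (f : C -> C) : Prop :=
  analytic_on_disk f /\ f 0 = 0 /\ is_derive f (RtoC 0) (RtoC 1).

Definition univalent_on_disk (f : C -> C) : Prop :=
  forall z w : C, unit_disk z -> unit_disk w -> f z = f w -> z = w.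

Definition disk_image (f : C -> C) (w : C) : Prop :=
  exists z : C, unit_disk z /\ f z = w.

Definition starlike_wrt (c : C) (S : C -> Prop) : Prop :=
  S c /\
  forall (w : C) (t : R), S w -> (0 <= t <= 1)%R -> S (c + RtoC t * (w - c)).

Definition symmetric_real_axis (S : C -> Prop) : Prop :=
  forall w : C, S w -> S (Cconj w).

Definition Ma_Minda (phi : C -> C) : Prop :=
  analytic_on_disk phi /\
  univalent_on_disk phi /\
  (forall z : C, unit_disk z -> (0 < Re (phi z))%R) /\
  phi 0 = 1 /\
  (exists b : R, (0 < b)%R /\ is_derive phi (RtoC 0) (RtoC b)) /\
  starlike_wrt 1 (disk_image phi) /\
  symmetric_real_axis (disk_image phi).

Definition subordinate (h phi : C -> C) : Prop :=
  exists omega : C -> C,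
    analytic_on_disk omega /\
    (forall z : C, unit_disk z -> unit_disk (omega z)) /\
    omega 0 = 0 /\
    (forall z : C, unit_disk z -> h z = phi (omega z)).

(** Division in [C] is total, so the non-vanishing of [f'], which is implicit
    in [1 + z f''(z) / f'(z)] being defined on the whole disk, is explicit. *)
Definition class_C (phi f : C -> C) : Prop :=
  class_A f /\
  (forall z : C, unit_disk z -> C_derive f z <> 0) /\
  subordinate (fun z => 1 + z * C_derive (C_derive f) z / C_derive f z) phi.

Definition det_T21 (a : nat -> C) : R := (1 - Cmod (a 2%nat) ^ 2)%R.

Definition det_T31 (a : nat -> C) : R :=
  (2 * Re (a 2%nat * a 2%nat * Cconj (a 3%nat))%C
   - 2 * Cmod (a 2%nat) ^ 2 - Cmod (a 3%nat) ^ 2 + 1)%R.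

Definition det2 (m11 m12 m21 m22 : C) : C := m11 * m22 - m12 * m21.

Definition det3 (m11 m12 m13 m21 m22 m23 m31 m32 m33 : C) : C :=
  m11 * det2 m22 m23 m32 m33 - m12 * det2 m21 m23 m31 m33
  + m13 * det2 m21 m22 m31 m32.

Lemma det_T21E (a : nat -> C) :
  RtoC (det_T21 a) = det2 1 (a 2%nat) (Cconj (a 2%nat)) 1.
Proof.
unfold det_T21, det2, Cmod; rewrite pow2_sqrt by nra.
destruct (a 2%nat) as [x y]; unfold Cconj, RtoC.
apply injective_projections; simpl; ring.
Qed.

Lemma det_T31E (a : nat -> C) :
  RtoC (det_T31 a) =
  det3 1                 (a 2%nat)         (a 3%nat)
       (Cconj (a 2%nat)) 1                 (a 2%nat)
       (Cconj (a 3%nat)) (Cconj (a 2%nat)) 1.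
Proof.
unfold det_T31, det3, det2, Cmod; rewrite !pow2_sqrt by nra.
destruct (a 2%nat) as [x y], (a 3%nat) as [u v]; unfold Cconj, RtoC, Re.
apply injective_projections; simpl; ring.
Qed.

(* Main.v *)
Require Import Defs.
From Stdlib Require Import Reals Lra Lia.
From Coquelicot Require Import Coquelicot.

Open Scope R_scope.

(** Everything rests on the second coefficient of [f]. Write
    [1 + z f'' / f' = phi o omega] with [omega] a self-map of the disk fixing
    [0]. Comparing derivatives at [0] gives [2 a_2 = B_1 omega' (0)]
    ([class_C_a2]), and the Schwarz lemma ([Schwarz_derive]) gives
    [|omega' (0)| <= 1], so [|a_2| <= B_1 / 2]. This is the lower bound for
    [det_T21]; its upper bound is the nonnegativity of [|a_2| ^ 2].

    For [det_T31], complete the square: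
    [det_T31 = 1 + |a_2| ^ 4 - 2 |a_2| ^ 2 - |a_3 - a_2 ^ 2| ^ 2], which is at
    most [1] as soon as [|a_2| <= 1]. Since [phi] has positive real part,
    [B_1 <= 2] ([Caratheodory_derive]), which gives exactly that.

    The Schwarz lemma is needed for functions that are only assumed complex
    differentiable. It is obtained from Goursat's theorem on rectangles
    ([rect_int_zero]) in the logarithmic coordinate, where it shows that
    [omega' (0)] is the mean of [omega (z) / z] over circles.

    For sharpness, the identity has [a_2 = a_3 = 0], and it belongs to the class
    with [omega = 0]; it attains both values [1]. The bound [1 - B_1 ^ 2 / 4]
    is attained for [omega = id], that is, by the [f] with
    [f'' (z) / f' (z) = (phi (z) - 1) / z]. That [f] and its expansion are constructed
    together from the recurrence for the coefficients of [f']
    ([exists_pre_Schwarzian]), which requires termwise differentiation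
    ([is_derive_expansion]) and Cauchy products ([has_expansion_mult]) of
    complex power series. *)

(** * Complex differentiation *)

Lemma is_derive_C_iff (f : C -> C) (z l : C) :
  is_derive f z l <->
  forall eps : R, 0 < eps -> exists delta : R, 0 < delta /\
    forall w : C, Cmod (w - z) < delta ->
      Cmod (f w - f z - (w - z) * l) <= eps * Cmod (w - z).
Proof.
split.
- intros [_ H] eps Heps.
  destruct (H z (fun P HP => HP) (mkposreal eps Heps)) as [d Hd].
  exists d; split; [apply cond_pos|]. intros w Hw. exact (Hd w Hw).
- intros H; split; [apply is_linear_scal_l|].
  intros x Hx.
  apply (is_filter_lim_locally_unique (V := AbsRing_NormedModule C_AbsRing)) in Hx. subst x.
  intros eps. destruct (H eps (cond_pos eps)) as [d [Hd Hw]].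
  exists (mkposreal d Hd). intros w Hw'. exact (Hw w Hw').
Qed.

Lemma locally_C_intro (P : C -> Prop) (z : C) (d : R) :
  0 < d -> (forall w, Cmod (w - z) < d -> P w) ->
  locally (T := AbsRing_UniformSpace C_AbsRing) z P.
Proof.
intros Hd HP. exists (mkposreal d Hd). intros w Hw. exact (HP w Hw).
Qed.

Lemma disk_margin (z w : C) :
  unit_disk z -> Cmod (w - z) < 1 - Cmod z -> unit_disk w.
Proof.
unfold unit_disk; intros Hz Hw.
replace w with (z + (w - z))%C by ring.
pose proof (Cmod_triangle z (w - z)). lra.
Qed.

Lemma unit_disk_0 : unit_disk 0.
Proof. unfold unit_disk; rewrite Cmod_0; lra. Qed.

Lemma is_derive_ext_disk (f g : C -> C) (z l : C) :
  (forall w, unit_disk w -> f w = g w) -> unit_disk z ->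
  is_derive f z l -> is_derive g z l.
Proof.
intros E Hz. apply is_derive_ext_loc.
apply (locally_C_intro _ z (1 - Cmod z)); [unfold unit_disk in Hz; lra|].
intros w Hw. apply E. now apply disk_margin with z.
Qed.

Lemma is_derive_C_id (z : C) : is_derive (fun w : C => w) z (RtoC 1).
Proof.
apply is_derive_C_iff. intros e He. exists 1; split; [lra|]. intros w _.
replace (w - z - (w - z) * 1)%C with (RtoC 0) by ring.
rewrite Cmod_0. pose proof (Cmod_ge_0 (w - z)). nra.
Qed.

(** The generic chain and product rules put on the codomain the norm topology
    of the scalar field, whereas the derivative of a map [C -> C] is by default
    taken for the product topology of [C]; both mean the same inequality. *)
Lemma is_derive_C_AbsRing (f : C -> C) (z l : C) :
  is_derive f z l <->
  is_derive (V := AbsRing_NormedModule C_AbsRing) f z l.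
Proof.
rewrite is_derive_C_iff. split.
- intros H; split; [apply is_linear_scal_l|].
  intros x Hx.
  apply (is_filter_lim_locally_unique (V := AbsRing_NormedModule C_AbsRing)) in Hx.
  subst x.
  intros eps. destruct (H eps (cond_pos eps)) as [d [Hd Hw]].
  exists (mkposreal d Hd). intros w Hw'. exact (Hw w Hw').
- intros [_ H] eps Heps.
  destruct (H z (fun P HP => HP) (mkposreal eps Heps)) as [d Hd].
  exists d; split; [apply cond_pos|]. intros w Hw. exact (Hd w Hw).
Qed.

Lemma is_derive_C_comp (f g : C -> C) (z df dg : C) :
  is_derive f (g z) df -> is_derive g z dg ->
  is_derive (fun w => f (g w)) z (df * dg)%C.
Proof.
intros Hf Hg. rewrite Cmult_comm.
apply (is_derive_comp (K := C_AbsRing) (V := C_NormedModule)); [exact Hf|].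
now apply is_derive_C_AbsRing.
Qed.

Lemma is_derive_C_mult (f g : C -> C) (z df dg : C) :
  is_derive f z df -> is_derive g z dg ->
  is_derive (fun w => f w * g w)%C z (df * g z + f z * dg)%C.
Proof.
intros Hf Hg. apply is_derive_C_AbsRing.
apply (is_derive_mult (K := C_AbsRing)); [| |exact Cmult_comm];
  now apply is_derive_C_AbsRing.
Qed.

Lemma is_derive_C_plus (f g : C -> C) (z df dg : C) :
  is_derive f z df -> is_derive g z dg ->
  is_derive (fun w => f w + g w)%C z (df + dg)%C.
Proof. intros Hf Hg. exact (is_derive_plus f g z df dg Hf Hg). Qed.

Lemma is_derive_C_const (c z : C) : is_derive (fun _ : C => c) z (RtoC 0).
Proof. exact (is_derive_const (V := C_NormedModule) c z). Qed.

Lemma is_derive_C_eq (f : C -> C) (z l l' : C) :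
  is_derive f z l -> l = l' -> is_derive f z l'.
Proof. intros H <-; exact H. Qed.

Lemma is_derive_C_inv (z : C) :
  z <> 0%C -> is_derive Cinv z (- / (z * z))%C.
Proof.
intros Hz. pose proof (proj1 (Cmod_gt_0 z) Hz) as Hm.
apply is_derive_C_iff. intros eps Heps.
exists (Rmin (Cmod z / 2) (eps * (Cmod z) ^ 3 / 2)). split.
{ apply Rmin_pos; [lra|]. pose proof (pow_lt _ 3 Hm). nra. }
intros w Hw.
pose proof (Rlt_le_trans _ _ _ Hw (Rmin_l _ _)) as H1.
pose proof (Rlt_le_trans _ _ _ Hw (Rmin_r _ _)) as H2.
assert (Hwm : Cmod z / 2 < Cmod w).
{ pose proof (Cmod_triangle w (z - w)). replace (w + (z - w))%C with z in H by ring.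
  replace (z - w)%C with (- (w - z))%C in H by ring. rewrite Cmod_opp in H. lra. }
assert (Hw0 : w <> 0%C) by (apply Cmod_gt_0; lra).
replace (/ w - / z - (w - z) * - / (z * z))%C
  with ((w - z) * (w - z) * / (w * (z * z)))%C by (field; auto).
rewrite !Cmod_mult, Cmod_inv, !Cmod_mult by (repeat apply Cmult_neq_0; auto).
set (d := Cmod (w - z)) in *. assert (0 <= d) by apply Cmod_ge_0.
assert (0 < Cmod w * (Cmod z * Cmod z)) by (repeat apply Rmult_lt_0_compat; lra).
apply Rmult_le_reg_r with (Cmod w * (Cmod z * Cmod z)); auto.
rewrite Rmult_assoc, Rinv_l by lra.
assert (d <= eps * (Cmod w * (Cmod z * Cmod z))).
{ simpl in H2.
  assert (eps * (Cmod z / 2 * (Cmod z * Cmod z)) <= eps * (Cmod w * (Cmod z * Cmod z))).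
  { apply Rmult_le_compat_l; [lra|]. apply Rmult_le_compat_r; nra. }
  nra. }
nra.
Qed.

Lemma is_derive_C_continuous (f : C -> C) (z l : C) :
  is_derive f z l -> forall eps, 0 < eps -> exists d, 0 < d /\
   forall w, Cmod (w - z) < d -> Cmod (f w - f z) < eps.
Proof.
intros Hf eps Heps.
pose proof (proj1 (is_derive_C_iff _ _ _) Hf 1 Rlt_0_1) as H.
destruct H as [d [Hd H]].
pose proof (Cmod_ge_0 l) as Hl.
assert (Hq : 0 < eps / (Cmod l + 2)) by (apply Rdiv_lt_0_compat; lra).
exists (Rmin d (eps / (Cmod l + 2))). split; [apply Rmin_pos; auto|].
intros w Hw.
pose proof (Rlt_le_trans _ _ _ Hw (Rmin_l _ _)) as H1.
pose proof (Rlt_le_trans _ _ _ Hw (Rmin_r _ _)) as H2.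
apply H in H1.
replace (f w - f z)%C with ((f w - f z - (w - z) * l) + (w - z) * l)%C by ring.
eapply Rle_lt_trans; [apply Cmod_triangle|]. rewrite Cmod_mult.
pose proof (Cmod_ge_0 (w - z)).
apply Rmult_lt_compat_r with (r := Cmod l + 2) in H2; [|lra].
unfold Rdiv in H2. rewrite Rmult_assoc, Rinv_l in H2 by lra. nra.
Qed.

Lemma Cmod_le_abs (z : C) : Cmod z <= Rabs (Re z) + Rabs (Im z).
Proof.
destruct z as [x y]; simpl.
replace (x, y) with (RtoC x + RtoC y * Ci)%C
  by (apply injective_projections; simpl; ring).
eapply Rle_trans; [apply Cmod_triangle|].
rewrite Cmod_mult, Cmod_Ci, !Cmod_R. lra.
Qed.

Lemma Im_le_Cmod (z : C) : Rabs (Im z) <= Cmod z.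
Proof. eapply Rle_trans; [apply Rmax_r|apply Rmax_Cmod]. Qed.

Lemma RInt_near_const (g : R -> R) (a b k K : R) :
  a <= b -> ex_RInt g a b ->
  (forall x, a <= x <= b -> Rabs (g x - k) <= K) ->
  Rabs (RInt g a b - k * (b - a)) <= K * (b - a).
Proof.
intros Hab Hg HK.
assert (C1 : forall c : R, RInt (fun _ => c) a b = c * (b - a)).
{ intros c. rewrite RInt_const. exact (Rmult_comm _ _). }
assert (H1 : RInt g a b <= (k + K) * (b - a)).
{ rewrite <- C1. apply RInt_le; auto; [apply ex_RInt_const|].
  intros x Hx. specialize (HK x ltac:(lra)). apply Rabs_le_between in HK. lra. }
assert (H2 : (k - K) * (b - a) <= RInt g a b).
{ rewrite <- C1. apply RInt_le; auto; [apply ex_RInt_const|].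
  intros x Hx. specialize (HK x ltac:(lra)). apply Rabs_le_between in HK. lra. }
apply Rabs_le_between. nra.
Qed.

(** * Goursat's theorem on rectangles *)

(** The imaginary part of the integral of [f (z) dz] around the rectangle
    [a, b] x [c, d]. One real component of the contour integral is enough
    for the mean value property of [Re f] on vertical segments, and it keeps
    all integrals real-valued. *)
Definition rect_int (f : C -> C) (a b c d : R) : R :=
  RInt (fun x => Im (f (x, c)) - Im (f (x, d))) a b
  + RInt (fun y => Re (f (b, y)) - Re (f (a, y))) c d.

Definition derivable_on_rect (f : C -> C) (a b c d : R) : Prop :=
  forall x y, a <= x <= b -> c <= y <= d -> ex_derive f ((x, y) : C).

Lemma derivable_on_sub_rect (f : C -> C) (a b c d a' b' c' d' : R) :
  derivable_on_rect f a b c d ->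
  a <= a' -> b' <= b -> c <= c' -> d' <= d ->
  derivable_on_rect f a' b' c' d'.
Proof. intros H ? ? ? ? x y Hx Hy. apply H; lra. Qed.

Lemma Cmod_real_shift (x x' y : R) : Cmod ((x', y) - (x, y)) = Rabs (x' - x).
Proof.
replace ((x', y) - (x, y))%C with (RtoC (x' - x))
  by (apply injective_projections; simpl; ring).
apply Cmod_R.
Qed.

Lemma Cmod_imag_shift (x y y' : R) : Cmod ((x, y') - (x, y)) = Rabs (y' - y).
Proof.
replace ((x, y') - (x, y))%C with (RtoC (y' - y) * Ci)%C
  by (apply injective_projections; simpl; ring).
rewrite Cmod_mult, Cmod_Ci, Cmod_R. ring.
Qed.

Lemma continuous_R_intro (g : R -> R) (x : R) :
  (forall eps, 0 < eps -> exists d, 0 < d /\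
     forall t, Rabs (t - x) < d -> Rabs (g t - g x) < eps) ->
  continuous g x.
Proof.
intros H. apply continuity_pt_filterlim.
intros eps Heps. destruct (H eps Heps) as [d [Hd Ht]].
exists d; split; [exact Hd|]. intros t [_ Hdist]. apply Ht. exact Hdist.
Qed.

Lemma ex_RInt_horizontal (f : C -> C) (a b y : R) :
  (forall x, a <= x <= b -> ex_derive f ((x, y) : C)) -> a <= b ->
  ex_RInt (fun x => Im (f (x, y))) a b.
Proof.
intros H Hab. apply (ex_RInt_continuous (V := R_CompleteNormedModule)).
rewrite Rmin_left, Rmax_right by auto. intros x Hx.
destruct (H x Hx) as [l Hl].
apply continuous_R_intro. intros eps Heps.
destruct (is_derive_C_continuous f _ l Hl eps Heps) as [d [Hd Hw]].
exists d; split; auto. intros t Ht.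
specialize (Hw (t, y)). rewrite Cmod_real_shift in Hw.
eapply Rle_lt_trans; [|exact (Hw Ht)].
exact (Im_le_Cmod (f (t, y) - f (x, y))%C).
Qed.

Lemma ex_RInt_vertical (f : C -> C) (x c d : R) :
  (forall y, c <= y <= d -> ex_derive f ((x, y) : C)) -> c <= d ->
  ex_RInt (fun y => Re (f (x, y))) c d.
Proof.
intros H Hab. apply (ex_RInt_continuous (V := R_CompleteNormedModule)).
rewrite Rmin_left, Rmax_right by auto. intros y Hy.
destruct (H y Hy) as [l Hl].
apply continuous_R_intro. intros eps Heps.
destruct (is_derive_C_continuous f _ l Hl eps Heps) as [e [He Hw]].
exists e; split; auto. intros t Ht.
specialize (Hw (x, t)). rewrite Cmod_imag_shift in Hw.
eapply Rle_lt_trans; [|exact (Hw Ht)].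
exact (re_le_Cmod (f (x, t) - f (x, y))%C).
Qed.

Lemma ex_RInt_sub (g h : R -> R) (a b : R) :
  ex_RInt g a b -> ex_RInt h a b -> ex_RInt (fun x => g x - h x) a b.
Proof. intros Hg Hh. exact (ex_RInt_minus (V := R_NormedModule) g h a b Hg Hh). Qed.

Lemma RInt_sub (g h : R -> R) (a b : R) :
  ex_RInt g a b -> ex_RInt h a b ->
  RInt (fun x => g x - h x) a b = RInt g a b - RInt h a b.
Proof. intros Hg Hh. exact (RInt_minus (V := R_CompleteNormedModule) g h a b Hg Hh). Qed.

Lemma rect_int_split_x (f : C -> C) (a m b c d : R) :
  a <= m <= b -> c <= d -> derivable_on_rect f a b c d ->
  rect_int f a b c d = rect_int f a m c d + rect_int f m b c d.
Proof.
intros Hm Hcd H. unfold rect_int.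
assert (Ix : forall s t y, a <= s -> s <= t -> t <= b -> c <= y <= d ->
  ex_RInt (fun x => Im (f (x, y))) s t).
{ intros s t y ? ? ? ?. apply ex_RInt_horizontal; auto. intros x Hx; apply H; lra. }
assert (Iy : forall x, a <= x <= b -> ex_RInt (fun y => Re (f (x, y))) c d).
{ intros x Hx. apply ex_RInt_vertical; auto. }
rewrite <- (RInt_Chasles (V := R_CompleteNormedModule) _ a m b)
  by (apply ex_RInt_sub; apply Ix; lra).
change (@plus (CompleteNormedModule.AbelianMonoid R_AbsRing R_CompleteNormedModule)) with Rplus.
rewrite !(RInt_sub (fun y => Re (f (_, y)))) by (apply Iy; lra). ring.
Qed.

Lemma rect_int_split_y (f : C -> C) (a b c m d : R) :
  a <= b -> c <= m <= d -> derivable_on_rect f a b c d ->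
  rect_int f a b c d = rect_int f a b c m + rect_int f a b m d.
Proof.
intros Hab Hm H. unfold rect_int.
assert (Ix : forall y, c <= y <= d -> ex_RInt (fun x => Im (f (x, y))) a b).
{ intros y Hy. apply ex_RInt_horizontal; auto. }
assert (Iy : forall s t x, c <= s -> s <= t -> t <= d -> a <= x <= b ->
  ex_RInt (fun y => Re (f (x, y))) s t).
{ intros s t x ? ? ? ?. apply ex_RInt_vertical; auto. intros y Hy; apply H; lra. }
rewrite <- (RInt_Chasles (V := R_CompleteNormedModule) _ c m d)
  by (apply ex_RInt_sub; apply Iy; lra).
change (@plus (CompleteNormedModule.AbelianMonoid R_AbsRing R_CompleteNormedModule)) with Rplus.
rewrite !(RInt_sub (fun x => Im (f (x, _)))) by (apply Ix; lra). ring.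
Qed.

(** The affine part of [f] at [z] contributes nothing: on the horizontal sides
    it gives the constant [(c - d) Re l], on the vertical ones [(b - a) Re l],
    and these cancel after integration. Only the remainder, which is at most
    [eps] times the semiperimeter, is left. *)
Lemma rect_int_local_bound (f : C -> C) (z l : C) (eps delta a b c d : R) :
  (forall w, Cmod (w - z) < delta ->
     Cmod (f w - f z - (w - z) * l) <= eps * Cmod (w - z)) ->
  0 < eps -> a <= Re z <= b -> c <= Im z <= d ->
  (b - a) + (d - c) < delta -> derivable_on_rect f a b c d ->
  Rabs (rect_int f a b c d) <= 2 * eps * ((b - a) + (d - c)) ^ 2.
Proof.
intros Hf Heps Hx0 Hy0 Hsmall H.
set (S := (b - a) + (d - c)) in *.
set (E := fun w => (f w - f z - (w - z) * l)%C).
assert (HE : forall x y, a <= x <= b -> c <= y <= d -> Cmod (E (x, y)) <= eps * S).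
{ intros x y Hx Hy.
  assert (Hw : Cmod ((x, y) - z) <= S).
  { eapply Rle_trans; [apply Cmod_le_abs|].
    destruct z as [x0 y0]; simpl in *. unfold S.
    apply Rplus_le_compat; apply Rabs_le_between; lra. }
  eapply Rle_trans; [apply Hf; lra|]. apply Rmult_le_compat_l; lra. }
assert (H1 : Rabs (RInt (fun x => Im (f (x, c)) - Im (f (x, d))) a b
                   - (c - d) * Re l * (b - a)) <= 2 * (eps * S) * (b - a)).
{ apply RInt_near_const; [lra| |].
  - apply ex_RInt_sub; apply ex_RInt_horizontal; try lra; intros; apply H; lra.
  - intros x Hx.
    replace (Im (f (x, c)) - Im (f (x, d)) - (c - d) * Re l)
      with (Im (E (x, c)) - Im (E (x, d))).
    2: { unfold E. destruct z, l. destruct (f _), (f _), (f _). simpl. ring. }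
    pose proof (HE x c Hx ltac:(lra)) as E1. pose proof (HE x d Hx ltac:(lra)) as E2.
    pose proof (Im_le_Cmod (E (x, c))) as E3. pose proof (Im_le_Cmod (E (x, d))) as E4.
    unfold Rminus at 1. eapply Rle_trans; [apply Rabs_triang|]. rewrite Rabs_Ropp. lra. }
assert (H2 : Rabs (RInt (fun y => Re (f (b, y)) - Re (f (a, y))) c d
                   - (b - a) * Re l * (d - c)) <= 2 * (eps * S) * (d - c)).
{ apply RInt_near_const; [lra| |].
  - apply ex_RInt_sub; apply ex_RInt_vertical; try lra; intros; apply H; lra.
  - intros y Hy.
    replace (Re (f (b, y)) - Re (f (a, y)) - (b - a) * Re l)
      with (Re (E (b, y)) - Re (E (a, y))).
    2: { unfold E. destruct z, l. destruct (f _), (f _), (f _). simpl. ring. }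
    pose proof (HE b y ltac:(lra) Hy) as E1. pose proof (HE a y ltac:(lra) Hy) as E2.
    pose proof (re_le_Cmod (E (b, y))) as E3. pose proof (re_le_Cmod (E (a, y))) as E4.
    unfold Rminus at 1. eapply Rle_trans; [apply Rabs_triang|]. rewrite Rabs_Ropp. lra. }
unfold rect_int.
set (I1 := RInt _ a b) in *. set (I2 := RInt _ c d) in *.
replace (I1 + I2) with ((I1 - (c - d) * Re l * (b - a)) + (I2 - (b - a) * Re l * (d - c))) by ring.
eapply Rle_trans; [apply Rabs_triang|].
replace (2 * eps * S ^ 2) with (2 * (eps * S) * (b - a) + 2 * (eps * S) * (d - c))
  by (unfold S; ring).
lra.
Qed.

(** The point is the supremum of the left ends: every right end bounds them. *)
Lemma nested_intervals (u v : nat -> R) :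
  (forall n, u n <= u (S n)) -> (forall n, v (S n) <= v n) ->
  (forall n, u n <= v n) -> exists x, forall n, u n <= x <= v n.
Proof.
intros Hu Hv Huv.
assert (Mu : forall n k, u n <= u (n + k)%nat).
{ intros n k; induction k; [rewrite Nat.add_0_r; lra|].
  rewrite Nat.add_succ_r. specialize (Hu (n + k)%nat). lra. }
assert (Mv : forall n k, v (n + k)%nat <= v n).
{ intros n k; induction k; [rewrite Nat.add_0_r; lra|].
  rewrite Nat.add_succ_r. specialize (Hv (n + k)%nat). lra. }
assert (Hb : forall n m, u m <= v n).
{ intros n m. pose proof (Mu m n). pose proof (Mv n m).
  rewrite Nat.add_comm in H0. specialize (Huv (m + n)%nat). lra. }
destruct (completeness (fun r => exists n, r = u n)) as [x [Hx1 Hx2]].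
- exists (v 0%nat). intros r [n ->]. apply Hb.
- exists (u 0%nat), 0%nat. reflexivity.
- exists x. intros n; split; [apply Hx1; now exists n|].
  apply Hx2. intros r [m ->]. apply Hb.
Qed.

(** Lower left corner of a quarter of the rectangle with lower left corner [p]
    and sides [h * A], [h * B]. The quarter is chosen by comparing
    numbers, so that the nested rectangles are defined by plain recursion. *)
Definition quarter_step (f : C -> C) (A B eta h : R) (p : R * R) : R * R :=
  let h' := h / 2 in
  let big a c := Rlt_dec (eta * h' ^ 2)
    (Rabs (rect_int f a (a + h' * A) c (c + h' * B))) in
  let (a, c) := p in
  if big a c then (a, c)
  else if big (a + h' * A) c then (a + h' * A, c)
  else if big a (c + h' * B) then (a, c + h' * B)
  else (a + h' * A, c + h' * B).

(** If the four quarters all had a boundary integral of at most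
    [eta * (h / 2) ^ 2], the whole would have at most [eta * h ^ 2]. *)
Lemma quarter_step_spec (f : C -> C) (A B eta h a c : R) :
  0 <= A -> 0 <= B -> 0 < h ->
  derivable_on_rect f a (a + h * A) c (c + h * B) ->
  eta * h ^ 2 < Rabs (rect_int f a (a + h * A) c (c + h * B)) ->
  let (a', c') := quarter_step f A B eta h (a, c) in
  a <= a' /\ a' + h / 2 * A <= a + h * A /\
  c <= c' /\ c' + h / 2 * B <= c + h * B /\
  eta * (h / 2) ^ 2
  < Rabs (rect_int f a' (a' + h / 2 * A) c' (c' + h / 2 * B)).
Proof.
intros HA HB Hh H Hbig.
assert (P : 0 <= h / 2 * A) by (apply Rmult_le_pos; lra).
assert (Q : 0 <= h / 2 * B) by (apply Rmult_le_pos; lra).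
assert (EA : h * A = h / 2 * A + h / 2 * A) by field.
assert (EB : h * B = h / 2 * B + h / 2 * B) by field.
assert (Hsplit : rect_int f a (a + h * A) c (c + h * B) =
   rect_int f a (a + h / 2 * A) c (c + h / 2 * B)
   + rect_int f (a + h / 2 * A) (a + h / 2 * A + h / 2 * A) c (c + h / 2 * B)
   + (rect_int f a (a + h / 2 * A) (c + h / 2 * B) (c + h / 2 * B + h / 2 * B)
   + rect_int f (a + h / 2 * A) (a + h / 2 * A + h / 2 * A)
        (c + h / 2 * B) (c + h / 2 * B + h / 2 * B))).
{ rewrite EA, EB, <- !Rplus_assoc in H |- *.
  rewrite (rect_int_split_y f _ _ c (c + h / 2 * B)) by (auto; lra).
  rewrite !(rect_int_split_x f a (a + h / 2 * A) (a + h / 2 * A + h / 2 * A));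
    try lra;
    apply (derivable_on_sub_rect _ _ _ _ _ _ _ _ _ H); lra. }
rewrite Hsplit in Hbig.
unfold quarter_step.
destruct (Rlt_dec _ _) as [|N1]; [repeat split; auto; lra|].
destruct (Rlt_dec _ _) as [|N2]; [repeat split; auto; lra|].
destruct (Rlt_dec _ _) as [|N3]; [repeat split; auto; lra|].
repeat split; try lra.
apply Rnot_lt_le in N1, N2, N3.
match type of Hbig with _ < Rabs (?r1 + ?r2 + (?r3 + ?r4)) =>
  pose proof (Rabs_triang (r1 + r2) (r3 + r4));
  pose proof (Rabs_triang r1 r2); pose proof (Rabs_triang r3 r4) end.
replace (eta * h ^ 2) with (4 * (eta * (h / 2) ^ 2)) in Hbig by field.
lra.
Qed.

(** Goursat's theorem. Were the integral nonzero, repeated quartering would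
    give rectangles shrinking to a point [(x, y)] whose integrals decrease no
    faster than their areas, while differentiability at [(x, y)] makes them
    of smaller order than the area. *)
Lemma rect_int_zero (f : C -> C) (a b c d : R) :
  a <= b -> c <= d -> derivable_on_rect f a b c d -> rect_int f a b c d = 0.
Proof.
intros Hab Hcd H.
destruct (Req_dec (rect_int f a b c d) 0) as [|Hne]; [assumption|exfalso].
set (A := b - a). set (B := d - c).
assert (HA : 0 <= A) by (unfold A; lra). assert (HB : 0 <= B) by (unfold B; lra).
set (eta := Rabs (rect_int f a b c d) / 2).
assert (Heta : 0 < eta) by (pose proof (Rabs_pos_lt _ Hne); unfold eta; lra).
set (h := fun n => (/ 2) ^ n).
assert (Hh : forall n, 0 < h n) by (intros n; apply pow_lt; lra).
assert (HhS : forall n, h (S n) = h n / 2) by (intros n; unfold h; simpl; lra).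
set (p := fix p n := match n with
   O => (a, c) | S n => quarter_step f A B eta (h n) (p n) end).
set (u := fun n => fst (p n)). set (v := fun n => snd (p n)).
assert (Inv : forall n, a <= u n /\ u n + h n * A <= b /\
   c <= v n /\ v n + h n * B <= d /\
   eta * h n ^ 2 < Rabs (rect_int f (u n) (u n + h n * A) (v n) (v n + h n * B))).
{ intros n; induction n as [|n [I1 [I2 [I3 [I4 I5]]]]].
  - unfold u, v, h; simpl. replace (a + 1 * A) with b by (unfold A; ring).
    replace (c + 1 * B) with d by (unfold B; ring).
    repeat split; try lra. unfold eta. unfold eta in Heta. lra.
  - pose proof (quarter_step_spec f A B eta (h n) (u n) (v n) HA HB (Hh n)) as St.
    assert (E : p (S n) = quarter_step f A B eta (h n) (u n, v n)).
    { unfold u, v. rewrite <- surjective_pairing. reflexivity. }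
    rewrite <- E in St. rewrite HhS. unfold u at 1 2 3 4, v at 1 2 3 4.
    destruct (p (S n)) as [a' c']; cbn [fst snd].
    destruct St as [S1 [S2 [S3 [S4 S5]]]]; auto.
    { apply (derivable_on_sub_rect _ _ _ _ _ _ _ _ _ H); lra. }
    repeat split; auto; lra. }
assert (Step : forall n, u n <= u (S n) /\ u (S n) + h (S n) * A <= u n + h n * A /\
   v n <= v (S n) /\ v (S n) + h (S n) * B <= v n + h n * B).
{ intros n. destruct (Inv n) as [I1 [I2 [I3 [I4 I5]]]].
  pose proof (quarter_step_spec f A B eta (h n) (u n) (v n) HA HB (Hh n)) as St.
  assert (E : p (S n) = quarter_step f A B eta (h n) (u n, v n)).
  { unfold u, v. rewrite <- surjective_pairing. reflexivity. }
  rewrite <- E in St. rewrite HhS. unfold u at 2 3, v at 2 3.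
  destruct (p (S n)) as [a' c']; cbn [fst snd].
  destruct St as [S1 [S2 [S3 [S4 S5]]]]; auto.
  apply (derivable_on_sub_rect _ _ _ _ _ _ _ _ _ H); lra. }
destruct (nested_intervals u (fun n => u n + h n * A)) as [x Hx].
{ intros n; apply Step. } { intros n; apply Step. }
{ intros n. pose proof (Rmult_le_pos _ _ (Rlt_le _ _ (Hh n)) HA). lra. }
destruct (nested_intervals v (fun n => v n + h n * B)) as [y Hy].
{ intros n; apply Step. } { intros n; apply Step. }
{ intros n. pose proof (Rmult_le_pos _ _ (Rlt_le _ _ (Hh n)) HB). lra. }
assert (Hxy : ex_derive f ((x, y) : C)).
{ apply H; [specialize (Hx 0%nat)|specialize (Hy 0%nat)];
    destruct (Inv 0%nat) as [I1 [I2 [I3 [I4 _]]]]; lra. }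
destruct Hxy as [l Hl].
(* The summand 1 keeps [K] positive for a degenerate rectangle. *)
set (K := A + B + 1).
assert (HK : 0 < K) by (unfold K; lra).
assert (Heps : 0 < eta / (2 * K ^ 2)).
{ apply Rdiv_lt_0_compat; [lra|]. pose proof (pow_lt K 2 HK). lra. }
destruct (proj1 (is_derive_C_iff _ _ _) Hl _ Heps) as [delta [Hd Hloc]].
destruct (pow_lt_1_zero (/ 2) ltac:(rewrite Rabs_right; lra) (delta / K)) as [N HN].
{ apply Rdiv_lt_0_compat; lra. }
specialize (HN N (Nat.le_refl _)). fold (h N) in HN.
rewrite Rabs_right in HN by (apply Rle_ge, Rlt_le, Hh).
apply Rmult_lt_compat_r with (r := K) in HN; [|lra].
unfold Rdiv in HN. rewrite Rmult_assoc, Rinv_l, Rmult_1_r in HN by lra.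
destruct (Inv N) as [I1 [I2 [I3 [I4 I5]]]].
specialize (Hx N). specialize (Hy N). cbv beta in Hx, Hy.
pose proof (Hh N) as HhN.
pose proof (rect_int_local_bound f (x, y) l _ delta (u N) (u N + h N * A)
  (v N) (v N + h N * B) Hloc Heps Hx Hy) as Bd.
replace (u N + h N * A - u N + (v N + h N * B - v N)) with (h N * (A + B)) in Bd by ring.
specialize (Bd ltac:(unfold K in HN; nra)).
assert (Bd' := Bd ltac:(apply (derivable_on_sub_rect _ _ _ _ _ _ _ _ _ H); lra)).
assert (Fin : 2 * (eta / (2 * K ^ 2)) * (h N * (A + B)) ^ 2 <= eta * h N ^ 2).
{ replace (2 * (eta / (2 * K ^ 2)) * (h N * (A + B)) ^ 2)
    with (eta * h N ^ 2 * ((A + B) / K) ^ 2) by (field; lra).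
  rewrite <- (Rmult_1_r (eta * h N ^ 2)) at 2.
  apply Rmult_le_compat_l.
  { apply Rmult_le_pos; [lra|]. apply pow_le; lra. }
  assert (HQ : 0 <= (A + B) / K <= 1).
  { split; [apply Rle_mult_inv_pos; lra|].
    apply Rmult_le_reg_r with K; auto. unfold Rdiv.
    rewrite Rmult_assoc, Rinv_l by lra. unfold K; lra. }
  nra. }
lra.
Qed.

(** * The Schwarz lemma and the Caratheodory bound *)

Definition cexp (w : C) : C := (exp (Re w) * cos (Im w), exp (Re w) * sin (Im w)).

Lemma cexp_plus (v w : C) : cexp (v + w) = (cexp v * cexp w)%C.
Proof.
destruct v as [a b], w as [c d]; unfold cexp; simpl.
rewrite exp_plus, cos_plus, sin_plus.
apply injective_projections; simpl; ring.
Qed.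

Lemma Cmod_cexp (w : C) : Cmod (cexp w) = exp (Re w).
Proof.
unfold Cmod, cexp; simpl.
replace (exp (Re w) * cos (Im w) * (exp (Re w) * cos (Im w) * 1) +
  exp (Re w) * sin (Im w) * (exp (Re w) * sin (Im w) * 1))
  with (Rsqr (exp (Re w)) * (Rsqr (sin (Im w)) + Rsqr (cos (Im w))))
  by (unfold Rsqr; ring).
rewrite sin2_cos2, Rmult_1_r. apply sqrt_Rsqr, Rlt_le, exp_pos.
Qed.

Lemma cexp_opp_l (w : C) : (cexp (- w) * cexp w = 1)%C.
Proof.
rewrite <- cexp_plus. replace (- w + w)%C with (RtoC 0) by ring.
unfold cexp; simpl. rewrite exp_0, cos_0, sin_0.
apply injective_projections; simpl; ring.
Qed.

Lemma derivable_pt_lim_0_bound (f : R -> R) (l eps : R) :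
  derivable_pt_lim f 0 l -> 0 < eps ->
  exists d, 0 < d /\ forall t, Rabs t < d -> Rabs (f t - f 0 - l * t) <= eps * Rabs t.
Proof.
intros H Heps. destruct (H eps Heps) as [d Hd].
exists d; split; [apply cond_pos|]. intros t Ht.
destruct (Req_dec t 0) as [->|Hne].
{ replace (f 0 - f 0 - l * 0) with 0 by ring. rewrite Rabs_R0. lra. }
specialize (Hd t Hne Ht). rewrite Rplus_0_l in Hd.
replace (f t - f 0 - l * t) with (((f t - f 0) / t - l) * t) by (field; auto).
rewrite Rabs_mult. apply Rmult_le_compat_r; [apply Rabs_pos|lra].
Qed.

(** Componentwise, [exp x cos y - 1 - x] and [exp x sin y - y] are combinations
    of the first order remainders of [exp], [cos], [sin] at [0] and of the
    second order term [(exp x - 1) y]. *)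
Lemma is_derive_cexp_0 : is_derive cexp (RtoC 0) (RtoC 1).
Proof.
apply is_derive_C_iff. intros eps Heps.
set (e := Rmin (eps / 8) 1).
assert (He : 0 < e) by (apply Rmin_pos; lra).
assert (He1 : e <= 1) by apply Rmin_r.
assert (He8 : 8 * e <= eps).
{ assert (e <= eps / 8) by apply Rmin_l. lra. }
destruct (derivable_pt_lim_0_bound exp 1 e) as [d1 [P1 D1]]; auto.
{ exact derivable_pt_lim_exp_0. }
destruct (derivable_pt_lim_0_bound cos 0 e) as [d2 [P2 D2]]; auto.
{ pose proof (derivable_pt_lim_cos 0) as K. now rewrite sin_0, Ropp_0 in K. }
destruct (derivable_pt_lim_0_bound sin 1 e) as [d3 [P3 D3]]; auto.
{ pose proof (derivable_pt_lim_sin 0) as K. now rewrite cos_0 in K. }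
rewrite exp_0 in D1. rewrite cos_0 in D2. rewrite sin_0 in D3.
exists (Rmin (Rmin d1 (e / 2)) (Rmin d2 d3)). split; [repeat apply Rmin_pos; lra|].
intros w Hw. replace (w - 0)%C with w in * by ring.
pose proof (Rlt_le_trans _ _ _ Hw (Rmin_l _ _)) as H12.
pose proof (Rlt_le_trans _ _ _ Hw (Rmin_r _ _)) as H34.
pose proof (Rlt_le_trans _ _ _ H12 (Rmin_l _ _)) as H1.
pose proof (Rlt_le_trans _ _ _ H12 (Rmin_r _ _)) as H2.
pose proof (Rlt_le_trans _ _ _ H34 (Rmin_l _ _)) as H3.
pose proof (Rlt_le_trans _ _ _ H34 (Rmin_r _ _)) as H4.
pose proof (re_le_Cmod w) as Hx. pose proof (Im_le_Cmod w) as Hy.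
set (m := Cmod w) in *.
specialize (D1 (Re w) ltac:(lra)). specialize (D2 (Im w) ltac:(lra)).
specialize (D3 (Im w) ltac:(lra)).
destruct w as [x y]; cbn [Re Im fst snd] in *.
eapply Rle_trans; [apply Cmod_le_abs|].
replace (Re (cexp (x, y) - cexp 0 - (x, y) * 1)) with
  ((exp x - 1 - 1 * x) + exp x * (cos y - 1 - 0 * y)).
2: { unfold cexp; simpl. rewrite exp_0, ?cos_0, ?sin_0. ring. }
replace (Im (cexp (x, y) - cexp 0 - (x, y) * 1)) with
  (exp x * (sin y - 0 - 1 * y) + ((exp x - 1 - 1 * x) + x) * y).
2: { unfold cexp; simpl. rewrite exp_0, ?cos_0, ?sin_0. ring. }
pose proof (Rabs_triang (exp x - 1 - 1 * x) (exp x * (cos y - 1 - 0 * y))) as T1.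
pose proof (Rabs_triang (exp x * (sin y - 0 - 1 * y)) (((exp x - 1 - 1 * x) + x) * y)) as T2.
rewrite Rabs_mult in T1. rewrite (Rabs_mult (exp x)), (Rabs_mult (_ + x)) in T2.
pose proof (Rabs_triang (exp x - 1 - 1 * x) x) as T3.
pose proof (Rabs_pos x). pose proof (Rabs_pos y).
assert (Ex : Rabs (exp x) <= 3).
{ rewrite Rabs_right by (apply Rle_ge, Rlt_le, exp_pos).
  eapply Rle_trans; [|apply exp_le_3].
  destruct (Rle_lt_or_eq_dec x 1) as [L|E].
  - pose proof (Rle_abs x). lra.
  - left. now apply exp_increasing.
  - rewrite E; lra. }
assert (Q1 : Rabs (exp x) * Rabs (cos y - 1 - 0 * y) <= 3 * (e * Rabs y)).
{ apply Rmult_le_compat; auto using Rabs_pos. }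
assert (Q2 : Rabs (exp x) * Rabs (sin y - 0 - 1 * y) <= 3 * (e * Rabs y)).
{ apply Rmult_le_compat; auto using Rabs_pos. }
assert (Q3 : Rabs (exp x - 1 - 1 * x + x) * Rabs y <= e * Rabs y).
{ apply Rmult_le_compat_r; auto. nra. }
assert (X : e * Rabs x <= e * m) by (apply Rmult_le_compat_l; lra).
assert (Y : e * Rabs y <= e * m) by (apply Rmult_le_compat_l; lra).
assert (M : 8 * e * m <= eps * m) by (apply Rmult_le_compat_r; lra).
lra.
Qed.

Lemma is_derive_cexp (w : C) : is_derive cexp w (cexp w).
Proof.
assert (H : is_derive (fun z => cexp w * cexp (z + - w))%C w
  (0 * cexp (w + - w) + cexp w * (1 * (1 + 0)))%C).
{ apply (is_derive_C_mult (fun _ => cexp w) (fun z => cexp (z + - w))%C);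
    [apply is_derive_C_const|].
  apply (is_derive_C_comp cexp (fun z => z + - w)%C).
  - replace (w + - w)%C with (RtoC 0) by ring. exact is_derive_cexp_0.
  - apply is_derive_C_plus; [apply is_derive_C_id|apply is_derive_C_const]. }
replace (0 * cexp (w + - w) + cexp w * (1 * (1 + 0)))%C with (cexp w) in H by ring.
revert H. apply is_derive_ext. intros z. rewrite <- cexp_plus. f_equal. ring.
Qed.

(** In the variable [w = log z] the circles around [0] become vertical segments
    of length [2 PI], and [G (w) = omega (exp w) / exp w] is differentiable and
    [2 PI i]-periodic on [Re w < 0]. The horizontal sides of a rectangle of
    height [2 PI] cancel by periodicity, so Goursat's theorem says that the mean
    of [Re G] over such a segment does not depend on its abscissa [s]. As
    [s] tends to minus infinity the mean tends to [Re l]; as [s] tends to [0]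
    it is at most [exp (- s)], which tends to [1]. *)
Lemma Schwarz_re (omega : C -> C) (l : C) :
  analytic_on_disk omega ->
  (forall z, unit_disk z -> unit_disk (omega z)) ->
  omega 0%C = 0%C -> is_derive omega (RtoC 0) l -> Re l <= 1.
Proof.
intros Han Hdisk H0 Hl.
destruct (Rle_lt_dec (Re l) 1) as [|Hgt]; [assumption|exfalso].
set (G := fun w => (omega (cexp w) * cexp (- w))%C).
(* [exp (- s2)] is the midpoint of [1] and [Re l], and [e] below is a third of
   their distance, so that [exp (- s2) < Re l - e]. *)
set (s2 := - ln ((Re l + 1) / 2)).
assert (Hln : 0 < ln ((Re l + 1) / 2)) by (rewrite <- ln_1; apply ln_increasing; lra).
assert (Hs2 : s2 < 0) by (unfold s2; lra).
set (e := (Re l - 1) / 3).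
assert (He : 0 < e) by (unfold e; lra).
destruct (proj1 (is_derive_C_iff _ _ _) Hl e He) as [d [Hd Hloc]].
set (s1 := Rmin s2 (ln (d / 2))).
assert (Hs12 : s1 <= s2) by apply Rmin_l.
assert (Hs1 : exp s1 < d).
{ apply Rle_lt_trans with (d / 2); [|lra].
  rewrite <- (exp_ln (d / 2)) by lra.
  destruct (Rle_lt_or_eq_dec s1 (ln (d / 2))) as [L|E]; [apply Rmin_r| |].
  - left; now apply exp_increasing.
  - rewrite E; lra. }
assert (Hin : forall w, Re w < 0 -> unit_disk (cexp w)).
{ intros w Hw. unfold unit_disk. rewrite Cmod_cexp, <- exp_0.
  now apply exp_increasing. }
assert (HG : derivable_on_rect G s1 s2 0 (2 * PI)).
{ intros x y Hx _. destruct (Han (cexp (x, y))) as [k Hk]; [apply Hin; simpl; lra|].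
  eexists.
  apply (is_derive_C_mult (fun w => omega (cexp w)) (fun w => cexp (- w)))%C.
  - apply (is_derive_C_comp omega cexp); [exact Hk|apply is_derive_cexp].
  - apply (is_derive_C_comp cexp Copp); [apply is_derive_cexp|].
    apply (is_derive_opp (V := C_NormedModule)). apply is_derive_C_id. }
pose proof PI_RGT_0 as HPI.
pose proof (rect_int_zero G s1 s2 0 (2 * PI) Hs12 ltac:(lra) HG) as Z.
unfold rect_int in Z.
rewrite (RInt_ext (V := R_CompleteNormedModule) _ (fun _ => 0) s1 s2) in Z.
2: { intros x _. unfold G, cexp; simpl.
  rewrite !cos_neg, !sin_neg, sin_2PI, cos_2PI, sin_0, cos_0, Ropp_0.
  apply Rminus_diag_eq. reflexivity. }
rewrite (RInt_const (V := R_CompleteNormedModule)) in Z.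
change (scal (s2 - s1) 0) with ((s2 - s1) * 0) in Z.
assert (Iv : forall x, s1 <= x <= s2 -> ex_RInt (fun y => Re (G (x, y))) 0 (2 * PI)).
{ intros x Hx. apply ex_RInt_vertical; [|lra]. intros y Hy. now apply HG. }
rewrite RInt_sub in Z by (apply Iv; lra).
assert (CI : forall c : R, RInt (fun _ => c) 0 (2 * PI) = 2 * PI * c).
{ intros c. rewrite (RInt_const (V := R_CompleteNormedModule)).
  change (scal (2 * PI - 0) c) with ((2 * PI - 0) * c).
  now rewrite Rminus_0_r. }
assert (U : RInt (fun y => Re (G (s2, y))) 0 (2 * PI) <= 2 * PI * ((Re l + 1) / 2)).
{ rewrite <- CI. apply RInt_le; [lra|apply Iv; lra|apply ex_RInt_const|].
  intros y _. eapply Rle_trans; [apply Rle_abs|].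
  eapply Rle_trans; [apply re_le_Cmod|].
  unfold G. rewrite Cmod_mult, Cmod_cexp.
  change (Re (- (s2, y))%C) with (- s2). unfold s2 at 2. rewrite Ropp_involutive, exp_ln by lra.
  assert (Ho : Cmod (omega (cexp (s2, y))) < 1) by (apply Hdisk, Hin; simpl; lra).
  nra. }
assert (L : 2 * PI * (Re l - e) <= RInt (fun y => Re (G (s1, y))) 0 (2 * PI)).
{ rewrite <- CI. apply RInt_le; [lra|apply ex_RInt_const|apply Iv; lra|].
  intros y _.
  assert (B : Cmod (G (s1, y) - l) <= e).
  { set (w := (s1, y) : C).
    replace (G w - l)%C with ((omega (cexp w) - omega 0%C - (cexp w - 0) * l) * cexp (- w))%C.
    2: { unfold G. rewrite H0. transitivity
          (omega (cexp w) * cexp (- w) - (cexp (- w) * cexp w) * l)%C; [ring|].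
      rewrite cexp_opp_l. ring. }
    assert (Hw : Cmod (cexp w - 0) = exp s1).
    { replace (cexp w - 0)%C with (cexp w) by ring. apply Cmod_cexp. }
    specialize (Hloc (cexp w) ltac:(lra)). rewrite Hw in Hloc.
    rewrite Cmod_mult, Cmod_cexp. change (Re (- w)%C) with (- s1). rewrite exp_Ropp.
    apply Rmult_le_reg_r with (exp s1); [apply exp_pos|].
    rewrite Rmult_assoc, Rinv_l, Rmult_1_r; [exact Hloc|].
    apply Rgt_not_eq, exp_pos. }
  pose proof (re_le_Cmod (G (s1, y) - l)) as B2.
  change (Re (G (s1, y) - l)%C) with (Re (G (s1, y)) - Re l) in B2.
  pose proof (proj1 (Rabs_le_between _ _) (Rle_trans _ _ _ B2 B)). lra. }
unfold e in L. nra.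
Qed.

(** A rotation of [omega] makes its derivative at [0] real and nonnegative. *)
Lemma Schwarz_derive (omega : C -> C) (l : C) :
  analytic_on_disk omega ->
  (forall z, unit_disk z -> unit_disk (omega z)) ->
  omega 0%C = 0%C -> is_derive omega (RtoC 0) l -> Cmod l <= 1.
Proof.
intros Han Hdisk H0 Hl.
destruct (Req_dec (Cmod l) 0) as [E|Hne]; [lra|].
assert (Hpos : 0 < Cmod l) by (pose proof (Cmod_ge_0 l); lra).
set (u := (Cconj l / Cmod l)%C).
assert (HC : RtoC (Cmod l) <> 0%C) by (intros E; apply RtoC_inj in E; lra).
assert (Hu : Cmod u = 1).
{ unfold u. rewrite Cmod_div, Cmod_conj, Cmod_R, Rabs_right by (auto; lra). now field. }
assert (Hul : (u * l)%C = RtoC (Cmod l)).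
{ unfold u. replace (Cconj l / Cmod l * l)%C with (l * Cconj l / Cmod l)%C by (now field).
  rewrite <- Cmod2_conj, RtoC_pow. now field. }
assert (D : forall z k, is_derive omega z k ->
   is_derive (fun w => u * omega w)%C z (u * k)%C).
{ intros z k Hk. replace (u * k)%C with (0 * omega z + u * k)%C by ring.
  apply (is_derive_C_mult (fun _ => u) omega); [apply is_derive_C_const|exact Hk]. }
change (Cmod l) with (Re (RtoC (Cmod l))). rewrite <- Hul.
apply (Schwarz_re (fun w => u * omega w)%C).
- intros z Hz. destruct (Han z Hz) as [k Hk]. exists (u * k)%C. now apply D.
- intros z Hz. unfold unit_disk. rewrite Cmod_mult, Hu, Rmult_1_l. now apply Hdisk.
- rewrite H0. ring.
- now apply D.
Qed.

(** The map [(phi - 1) / (phi + 1)] sends the disk to itself and [0] to [0],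
    and its derivative at [0] is [b / 2]. *)
Lemma Caratheodory_derive (phi : C -> C) (b : C) :
  analytic_on_disk phi -> (forall z, unit_disk z -> 0 < Re (phi z)) ->
  phi 0%C = 1%C -> is_derive phi (RtoC 0) b -> Cmod b <= 2.
Proof.
intros Han Hre H0 Hb.
assert (Hnz : forall z, unit_disk z -> (phi z + 1)%C <> 0%C).
{ intros z Hz E. specialize (Hre z Hz). apply (f_equal Re) in E. simpl in E.
  unfold Re in Hre. lra. }
assert (D : forall z k, unit_disk z -> is_derive phi z k ->
  is_derive (fun w => (phi w + - (1)) * / (phi w + 1))%C z
   ((k + 0) * / (phi z + 1) + (phi z + - (1)) *
      (- / ((phi z + 1) * (phi z + 1)) * (k + 0)))%C).
{ intros z k Hz Hk.
  apply (is_derive_C_mult (fun w => phi w + - (1)) (fun w => / (phi w + 1)))%C.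
  - apply is_derive_C_plus; [exact Hk|apply is_derive_C_const].
  - apply (is_derive_C_comp Cinv (fun w => phi w + 1)%C).
    + apply is_derive_C_inv. now apply Hnz.
    + apply is_derive_C_plus; [exact Hk|apply is_derive_C_const]. }
assert (S : Cmod (b / 2) <= 1).
{ apply (Schwarz_derive (fun w => (phi w + - (1)) * / (phi w + 1))%C).
  - intros z Hz. destruct (Han z Hz) as [k Hk]. eexists. exact (D z k Hz Hk).
  - intros z Hz. unfold unit_disk. specialize (Hre z Hz).
    rewrite Cmod_mult, Cmod_inv by (now apply Hnz).
    assert (P : 0 < Cmod (phi z + 1)) by (now apply Cmod_gt_0, Hnz).
    apply Rmult_lt_reg_r with (Cmod (phi z + 1)); auto.
    rewrite Rmult_assoc, Rinv_l, Rmult_1_r, Rmult_1_l by lra.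
    unfold Cmod. apply sqrt_lt_1_alt.
    destruct (phi z) as [x y]; simpl in *. clear - Hre.
    rewrite Ropp_0, !Rplus_0_r, !Rmult_1_r.
    pose proof (Rle_0_sqr (x + - (1))). pose proof (Rle_0_sqr y).
    unfold Rsqr in *. split; lra.
  - rewrite H0. apply injective_projections; simpl; field.
  - eapply is_derive_C_eq; [apply D; [exact unit_disk_0|exact Hb]|].
    rewrite H0. field. }
assert (H2 : RtoC 2 <> 0%C) by (intros E; apply RtoC_inj in E; lra).
rewrite Cmod_div, Cmod_R, Rabs_right in S by (auto; lra). lra.
Qed.

(** * Complex power series on the unit disk *)

(** [C] is a normed module over [R] as well as over [C]; this fixes the latter. *)
Notation is_series_C := (is_series (K := C_AbsRing) (V := C_NormedModule)).

Lemma is_pseries_C_iff (a : nat -> C) (z l : C) :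
  is_pseries a z l <-> is_series_C (fun n => z ^ n * a n)%C l.
Proof.
assert (E : forall n, pow_n (K := C_Ring) z n = (z ^ n)%C).
{ induction n; simpl; [reflexivity|]. now rewrite IHn. }
unfold is_pseries. split; apply is_series_ext; intros n.
- exact (f_equal (fun u => u * a n)%C (E n)).
- exact (f_equal (fun u => u * a n)%C (eq_sym (E n))).
Qed.

Lemma Re_sum_n (s : nat -> C) (n : nat) :
  Re (sum_n s n) = sum_n (fun k => Re (s k)) n.
Proof.
induction n; [now rewrite !sum_O|].
rewrite !sum_Sn, <- IHn. reflexivity.
Qed.

Lemma Im_sum_n (s : nat -> C) (n : nat) :
  Im (sum_n s n) = sum_n (fun k => Im (s k)) n.
Proof.
induction n; [now rewrite !sum_O|].
rewrite !sum_Sn, <- IHn. reflexivity.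
Qed.

Lemma is_series_C_iff (s : nat -> C) (l : C) :
  is_series_C s l <->
  is_series (fun n => Re (s n)) (Re l) /\ is_series (fun n => Im (s n)) (Im l).
Proof.
unfold is_series. split.
- intros Hl. pose proof (proj1 (filterlim_locally _ _) Hl) as H.
  split; apply filterlim_locally; intros eps;
    destruct (H eps) as [N HN]; exists N; intros n Hn; destruct (HN n Hn) as [H1 H2].
  + rewrite <- Re_sum_n. exact H1.
  + rewrite <- Im_sum_n. exact H2.
- intros [H1 H2].
  pose proof (proj1 (filterlim_locally _ _) H1) as H1'.
  pose proof (proj1 (filterlim_locally _ _) H2) as H2'.
  apply filterlim_locally. intros eps.
  destruct (H1' eps) as [N1 HN1]. destruct (H2' eps) as [N2 HN2].
  exists (max N1 N2). intros n Hn.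
  specialize (HN1 n ltac:(lia)). specialize (HN2 n ltac:(lia)).
  rewrite <- Re_sum_n in HN1. rewrite <- Im_sum_n in HN2. split; assumption.
Qed.

Lemma is_series_C_unique (s : nat -> C) (l l' : C) :
  is_series_C s l -> is_series_C s l' -> l = l'.
Proof.
intros H H'. apply is_series_C_iff in H, H'.
apply injective_projections.
- change (Re l = Re l'). rewrite <- (is_series_unique _ _ (proj1 H)). apply is_series_unique, H'.
- change (Im l = Im l'). rewrite <- (is_series_unique _ _ (proj2 H)). apply is_series_unique, H'.
Qed.

Lemma ex_series_C_abs (s : nat -> C) (b : nat -> R) :
  (forall n, Cmod (s n) <= b n) -> ex_series b -> exists l : C, is_series_C s l.
Proof.
intros Hb Hs.
assert (H1 : ex_series (fun n => Re (s n))).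
{ apply (ex_series_le (V := R_CompleteNormedModule)) with b; auto. intros n.
  eapply Rle_trans; [exact (re_le_Cmod (s n))|auto]. }
assert (H2 : ex_series (fun n => Im (s n))).
{ apply (ex_series_le (V := R_CompleteNormedModule)) with b; auto. intros n.
  eapply Rle_trans; [exact (Im_le_Cmod (s n))|auto]. }
destruct H1 as [x Hx], H2 as [y Hy].
exists (x, y). apply is_series_C_iff. now split.
Qed.

Lemma is_series_C_bound (s : nat -> C) (b : nat -> R) (l : C) (m : R) :
  is_series_C s l -> is_series b m -> (forall n, Cmod (s n) <= b n) -> Cmod l <= m.
Proof.
intros Hs Hb Hle.
apply (is_lim_seq_le (fun n => Cmod (sum_n s n)) (sum_n b) (Cmod l) m).
- intros n. eapply Rle_trans; [apply (norm_sum_n_m (V := C_NormedModule))|].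
  apply sum_n_m_le. exact Hle.
- exact (filterlim_comp _ _ _ _ _ _ _ _ Hs (filterlim_norm (V := C_NormedModule) l)).
- exact Hb.
Qed.

(** This bound says that the power series with coefficients [a] converges in
    the unit disk. Unlike convergence itself it is checked term by term, so it
    passes easily to the coefficients of derivatives and primitives and to
    sequences given by a recurrence. *)
Definition subexponential (a : nat -> C) : Prop :=
  forall r, 0 < r < 1 -> exists M, forall n, Cmod (a n) * r ^ n <= M.

Lemma has_expansion_subexponential (f : C -> C) (a : nat -> C) :
  has_expansion f a -> subexponential a.
Proof.
intros H r Hr.
assert (Hz : unit_disk (RtoC r)) by (unfold unit_disk; rewrite Cmod_R, Rabs_right; lra).
specialize (H _ Hz). apply (proj1 (is_pseries_C_iff _ _ _)) in H.
destruct (filterlim_bounded (V := C_NormedModule) _ (ex_intro _ _ H)) as [M HM].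
exists (2 * M). intros n.
replace (Cmod (a n) * r ^ n) with (Cmod (RtoC r ^ n * a n)).
2: { rewrite Cmod_mult, Cmod_pow, Cmod_R, Rabs_right by lra. ring. }
assert (P : 0 <= M) by (eapply Rle_trans; [apply (norm_ge_0 (V := C_NormedModule))|apply (HM 0%nat)]).
destruct n as [|n].
- specialize (HM 0%nat). rewrite sum_O in HM. eapply Rle_trans; [exact HM|]. lra.
- pose proof (HM n) as M1. pose proof (HM (S n)) as M2. rewrite sum_Sn in M2.
  set (s := sum_n _ n) in *.
  change (Cmod s <= M) in M1.
  change (Cmod (s + (RtoC r ^ S n * a (S n)))%C <= M) in M2.
  replace (RtoC r ^ S n * a (S n))%C
    with ((s + (RtoC r ^ S n * a (S n))) + - s)%C by ring.
  eapply Rle_trans; [apply Cmod_triangle|]. rewrite Cmod_opp. lra.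
Qed.

Lemma ex_series_subexponential (a : nat -> C) (r : R) :
  subexponential a -> 0 <= r < 1 -> ex_series (fun n => Cmod (a n) * r ^ n).
Proof.
intros Ha Hr. set (r' := (1 + r) / 2).
assert (Hr' : 0 < r' < 1) by (unfold r'; lra).
destruct (Ha r' Hr') as [M HM].
assert (Hq : 0 <= r / r' < 1).
{ split; [apply Rle_mult_inv_pos; lra|].
  apply Rmult_lt_reg_r with r'; [lra|]. unfold Rdiv.
  rewrite Rmult_assoc, Rinv_l by lra. unfold r'; lra. }
apply (ex_series_le (V := R_CompleteNormedModule)) with (fun n => M * (r / r') ^ n).
- intros n. change (Rabs (Cmod (a n) * r ^ n) <= M * (r / r') ^ n).
  rewrite Rabs_right.
  2: { apply Rle_ge, Rmult_le_pos; [apply Cmod_ge_0|apply pow_le; lra]. }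
  replace (Cmod (a n) * r ^ n) with (Cmod (a n) * r' ^ n * (r / r') ^ n).
  2: { rewrite Rmult_assoc, <- Rpow_mult_distr. do 2 f_equal. field. lra. }
  apply Rmult_le_compat_r; [apply pow_le; lra|apply HM].
- apply (ex_series_scal_l (K := R_AbsRing) (V := R_NormedModule) M (fun n => (r / r') ^ n)).
  apply ex_series_geom. rewrite Rabs_right; lra.
Qed.

Lemma subexponential_expansion (a : nat -> C) :
  subexponential a -> exists f, has_expansion f a.
Proof.
intros Ha.
exists (fun z => (Series (fun n => Re (z ^ n * a n)%C), Series (fun n => Im (z ^ n * a n)%C))).
intros z Hz. apply (proj2 (is_pseries_C_iff _ _ _)).
destruct (ex_series_C_abs (fun n => z ^ n * a n)%C (fun n => Cmod (a n) * Cmod z ^ n))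
  as [l Hl].
- intros n. rewrite Cmod_mult, Cmod_pow. lra.
- apply ex_series_subexponential; auto. split; [apply Cmod_ge_0|exact Hz].
- pose proof (proj1 (is_series_C_iff _ _) Hl) as [H1 H2].
  rewrite (is_series_unique _ _ H1), (is_series_unique _ _ H2).
  rewrite <- surjective_pairing. exact Hl.
Qed.

(** [n q ^ n] is at most [1 + q + ... + q ^ (n - 1)], since each of these
    powers is at least [q ^ n]. *)
Lemma pow_weight_bound (q : R) (n : nat) :
  0 <= q < 1 -> INR n * q ^ n <= / (1 - q).
Proof.
intros Hq.
assert (H : INR n * q ^ n <= (1 - q ^ n) / (1 - q)).
{ induction n as [|n IH].
  - simpl. unfold Rdiv. lra.
  - rewrite S_INR. simpl.
    assert (P : 0 <= q ^ n) by (apply pow_le; lra).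
    assert (Q : q ^ n <= 1).
    { rewrite <- (pow1 n). apply pow_incr. lra. }
    replace ((1 - q * q ^ n) / (1 - q)) with ((1 - q ^ n) / (1 - q) + q ^ n) by (field; lra).
    assert (N : 0 <= INR n * q ^ n) by (apply Rmult_le_pos; [apply pos_INR|exact P]).
    replace ((INR n + 1) * (q * q ^ n)) with (q * (INR n * q ^ n) + q * q ^ n) by ring.
    nra. }
eapply Rle_trans; [exact H|]. unfold Rdiv.
assert (0 <= / (1 - q)) by (apply Rlt_le, Rinv_0_lt_compat; lra).
assert (0 <= q ^ n) by (apply pow_le; lra). nra.
Qed.

Lemma subexponential_weight (a : nat -> C) :
  subexponential a -> subexponential (fun n => INR n * a n)%C.
Proof.
intros Ha r Hr. set (r' := (1 + r) / 2).
assert (Hr' : 0 < r' < 1) by (unfold r'; lra).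
destruct (Ha r' Hr') as [M HM].
assert (Hq : 0 <= r / r' < 1).
{ split; [apply Rle_mult_inv_pos; lra|].
  apply Rmult_lt_reg_r with r'; [lra|]. unfold Rdiv.
  rewrite Rmult_assoc, Rinv_l by lra. unfold r'; lra. }
exists (M * / (1 - r / r')). intros n.
rewrite Cmod_mult, Cmod_R, Rabs_right by (apply Rle_ge, pos_INR).
replace (INR n * Cmod (a n) * r ^ n)
  with ((Cmod (a n) * r' ^ n) * (INR n * (r / r') ^ n)).
2: { replace (r ^ n) with (r' ^ n * (r / r') ^ n); [ring|].
  rewrite <- Rpow_mult_distr. f_equal. field. lra. }
apply Rmult_le_compat; auto using pow_weight_bound.
- apply Rmult_le_pos; [apply Cmod_ge_0|apply pow_le; lra].
- apply Rmult_le_pos; [apply pos_INR|apply pow_le; lra].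
Qed.

Definition derive_coef (a : nat -> C) (n : nat) : C := (INR (S n) * a (S n))%C.

Lemma INR_S_neq_0 (n : nat) : RtoC (INR (S n)) <> 0%C.
Proof.
intros E. apply RtoC_inj in E. pose proof (lt_0_INR (S n) ltac:(lia)). lra.
Qed.

Lemma subexponential_shift (a : nat -> C) :
  subexponential a -> subexponential (fun n => a (S n)).
Proof.
intros Ha r Hr. destruct (Ha r Hr) as [M HM]. exists (M / r). intros n.
apply Rmult_le_reg_r with r; [lra|]. unfold Rdiv.
rewrite (Rmult_assoc M), Rinv_l by lra. specialize (HM (S n)). simpl in HM. lra.
Qed.

Lemma subexponential_derive (a : nat -> C) :
  subexponential a -> subexponential (derive_coef a).
Proof. intros Ha. exact (subexponential_shift _ (subexponential_weight a Ha)). Qed.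

(** The factor [rho] on the left replaces the exponent [n - 1] of the usual
    bound and so avoids a separate case for [n = 0]. The remainders [E n] obey
    [E (n + 1) = w E n + (n + 1) (w - z) ^ 2 z ^ n]. *)
Lemma pow_taylor_remainder (w z : C) (rho : R) (n : nat) :
  Cmod w <= rho -> Cmod z <= rho ->
  Cmod (w ^ S n - z ^ S n - INR (S n) * (w - z) * z ^ n) * rho
  <= INR n * INR (S n) * rho ^ n * Cmod (w - z) ^ 2.
Proof.
intros Hw Hz.
assert (Hr : 0 <= rho) by (eapply Rle_trans; [apply Cmod_ge_0|exact Hz]).
induction n as [|n IH].
- replace (w ^ 1 - z ^ 1 - INR 1 * (w - z) * z ^ 0)%C with (RtoC 0).
  2: { simpl. ring. }
  rewrite Cmod_0. simpl. lra.
- set (E := (w ^ S n - z ^ S n - INR (S n) * (w - z) * z ^ n)%C) in *.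
  replace (w ^ S (S n) - z ^ S (S n) - INR (S (S n)) * (w - z) * z ^ S n)%C
    with (w * E + INR (S n) * ((w - z) * (w - z)) * z ^ n)%C.
  2: { unfold E. rewrite (S_INR (S n)), RtoC_plus, !Cpow_S. ring. }
  assert (T : Cmod (w * E + INR (S n) * ((w - z) * (w - z)) * z ^ n)
     <= rho * Cmod E + INR (S n) * Cmod (w - z) ^ 2 * rho ^ n).
  { eapply Rle_trans; [apply Cmod_triangle|].
    rewrite !Cmod_mult, Cmod_pow, Cmod_R, (Rabs_right (INR _)) by (apply Rle_ge, pos_INR).
    apply Rplus_le_compat.
    - apply Rmult_le_compat_r; [apply Cmod_ge_0|exact Hw].
    - replace (Cmod (w - z) ^ 2) with (Cmod (w - z) * Cmod (w - z)) by ring.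
      apply Rmult_le_compat_l.
      + repeat apply Rmult_le_pos; try apply Cmod_ge_0; apply pos_INR.
      + apply pow_incr. split; [apply Cmod_ge_0|exact Hz]. }
  apply (Rmult_le_compat_r rho) in T; [|exact Hr].
  apply (Rmult_le_compat_l rho) in IH; [|exact Hr].
  eapply Rle_trans; [exact T|].
  replace ((rho * Cmod E + INR (S n) * Cmod (w - z) ^ 2 * rho ^ n) * rho)
    with (rho * (Cmod E * rho) + INR (S n) * Cmod (w - z) ^ 2 * rho ^ S n) by (simpl; ring).
  eapply Rle_trans; [apply Rplus_le_compat_r; exact IH|].
  rewrite (S_INR (S n)).
  assert (P : 0 <= INR (S n) * (rho ^ S n * Cmod (w - z) ^ 2)).
  { apply Rmult_le_pos; [apply pos_INR|]. apply Rmult_le_pos; [apply pow_le; auto|].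
    apply pow_le, Cmod_ge_0. }
  rewrite !S_INR in *. simpl in *. nra.
Qed.

(** Summing the Taylor remainders of the powers: the difference between the
    increment of [f] and [(w - z) g z] is at most [K |w - z| ^ 2 / rho], where
    [K] is the sum of [n |derive_coef a n| rho ^ n]. *)
Lemma is_derive_expansion (f g : C -> C) (a : nat -> C) (z : C) :
  has_expansion f a -> has_expansion g (derive_coef a) -> unit_disk z ->
  is_derive f z (g z).
Proof.
intros Hf Hg Hz.
pose proof (subexponential_derive a (has_expansion_subexponential f a Hf)) as Hsub.
pose proof Hz as Hz1. unfold unit_disk in Hz1. pose proof (Cmod_ge_0 z) as Hz0.
set (rho := (1 + Cmod z) / 2).
assert (Hrho : 0 < rho < 1 /\ Cmod z < rho) by (unfold rho; lra).
destruct (ex_series_subexponential _ rho (subexponential_weight _ Hsub) ltac:(lra)) as [K HK].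
assert (K0 : 0 <= K).
{ change 0 with (real 0). apply (is_lim_seq_le (fun _ => 0)
    (sum_n (fun n => Cmod (INR n * derive_coef a n) * rho ^ n)) 0 K).
  - intros n. induction n; [rewrite sum_O|rewrite sum_Sn].
    + apply Rmult_le_pos; [apply Cmod_ge_0|apply pow_le; lra].
    + apply Rplus_le_le_0_compat; [exact IHn|].
      apply Rmult_le_pos; [apply Cmod_ge_0|apply pow_le; lra].
  - apply is_lim_seq_const.
  - exact HK. }
apply is_derive_C_iff. intros eps Heps.
exists (Rmin (rho - Cmod z) (eps * rho / (K + 1))). split.
{ apply Rmin_pos; [lra|]. apply Rdiv_lt_0_compat; nra. }
intros w Hw.
pose proof (Rlt_le_trans _ _ _ Hw (Rmin_l _ _)) as W1.
pose proof (Rlt_le_trans _ _ _ Hw (Rmin_r _ _)) as W2.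
assert (Hwr : Cmod w <= rho).
{ replace w with (z + (w - z))%C by ring. pose proof (Cmod_triangle z (w - z)). lra. }
assert (Hwd : unit_disk w) by (unfold unit_disk; lra).
assert (Tail : forall v l : C, is_pseries a v l ->
  is_series_C (fun n => v ^ S n * a (S n))%C (l - a 0%nat)%C).
{ intros v l Hv. apply (proj1 (is_pseries_C_iff _ _ _)) in Hv.
  apply (is_series_incr_1 (V := C_NormedModule) (fun n => v ^ n * a n)%C).
  match goal with |- is_series _ ?x => replace x with l; [exact Hv|] end.
  change (@eq C l ((l - a 0%nat) + 1 * a 0%nat)%C). ring. }
pose proof (Tail w _ (Hf w Hwd)) as S1. pose proof (Tail z _ (Hf z Hz)) as S2.
pose proof (proj1 (is_pseries_C_iff _ _ _) (Hg z Hz)) as S3.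
pose proof (is_series_minus _ _ _ _ (is_series_minus _ _ _ _ S1 S2)
  (is_series_scal (V := C_NormedModule) (w - z)%C _ _ S3)) as S4.
assert (S5 : is_series_C (fun n => a (S n) *
     (w ^ S n - z ^ S n - INR (S n) * (w - z) * z ^ n))%C
   (f w - f z - (w - z) * g z)%C).
{ match type of S4 with is_series _ ?x =>
    replace (f w - f z - (w - z) * g z)%C with x end.
  - revert S4. apply is_series_ext. intros n.
    change (@eq C (w ^ S n * a (S n) - z ^ S n * a (S n)
      - (w - z) * (z ^ n * derive_coef a n))%C
      (a (S n) * (w ^ S n - z ^ S n - INR (S n) * (w - z) * z ^ n))%C).
    unfold derive_coef. ring.
  - change (@eq C ((f w - a 0%nat) - (f z - a 0%nat) - (w - z) * g z)%C
      (f w - f z - (w - z) * g z)%C). ring. }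
assert (Bd : Cmod (f w - f z - (w - z) * g z) <= Cmod (w - z) ^ 2 / rho * K).
{ refine (is_series_C_bound _ _ _ _ S5
    (is_series_scal_l (K := R_AbsRing) (Cmod (w - z) ^ 2 / rho) _ _ HK) _).
  intros n.
  change (Cmod (a (S n) * (w ^ S n - z ^ S n - INR (S n) * (w - z) * z ^ n))
    <= Cmod (w - z) ^ 2 / rho * (Cmod (INR n * derive_coef a n) * rho ^ n)).
  unfold derive_coef.
  pose proof (pow_taylor_remainder w z rho n Hwr ltac:(lra)) as R.
  rewrite (Cmod_mult (a (S n))), !(Cmod_mult (INR _)), !Cmod_R.
  rewrite !(Rabs_right (INR _)) by (apply Rle_ge, pos_INR).
  set (E := Cmod (_ - _ - _)%C) in *.
  apply Rmult_le_reg_r with rho; [lra|].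
  replace (Cmod (w - z) ^ 2 / rho * (INR n * (INR (S n) * Cmod (a (S n))) * rho ^ n) * rho)
    with (Cmod (a (S n)) * (INR n * INR (S n) * rho ^ n * Cmod (w - z) ^ 2)) by (field; lra).
  rewrite Rmult_assoc. apply Rmult_le_compat_l; [apply Cmod_ge_0|exact R]. }
eapply Rle_trans; [exact Bd|].
apply Rmult_lt_compat_r with (r := K + 1) in W2; [|lra].
unfold Rdiv in W2. rewrite (Rmult_assoc (eps * rho)), Rinv_l, Rmult_1_r in W2 by lra.
apply Rmult_le_reg_r with rho; [lra|].
replace (Cmod (w - z) ^ 2 / rho * K * rho) with (Cmod (w - z) * (Cmod (w - z) * K)) by (field; lra).
pose proof (Cmod_ge_0 (w - z)) as P.
replace (eps * Cmod (w - z) * rho) with (Cmod (w - z) * (eps * rho)) by ring.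
apply Rmult_le_compat_l; [exact P|]. lra.
Qed.

Lemma has_expansion_C_derive (f : C -> C) (a : nat -> C) :
  has_expansion f a ->
  has_expansion (C_derive f) (derive_coef a) /\
  (forall z, unit_disk z -> is_derive f z (C_derive f z)).
Proof.
intros Hf.
destruct (subexponential_expansion (derive_coef a)) as [g Hg].
{ eapply subexponential_derive, has_expansion_subexponential, Hf. }
assert (E : forall z, unit_disk z -> C_derive f z = g z).
{ intros z Hz. apply is_C_derive_unique. now apply is_derive_expansion with a. }
split; intros z Hz; rewrite E by auto; [now apply Hg|].
now apply is_derive_expansion with a.
Qed.

Lemma has_expansion_at_0 (f : C -> C) (a : nat -> C) :
  has_expansion f a -> f 0%C = a 0%nat.
Proof.
intros Hf.
exact (is_series_C_unique _ _ _ (Hf _ unit_disk_0) (is_pseries_0 (V := C_NormedModule) a)).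
Qed.

Lemma has_expansion_coef_ext (f : C -> C) (a b : nat -> C) :
  (forall n, a n = b n) -> has_expansion f a -> has_expansion f b.
Proof. intros E H z Hz. exact (is_pseries_ext a b z _ E (H z Hz)). Qed.

Lemma has_expansion_unique (f g : C -> C) (a : nat -> C) (z : C) :
  has_expansion f a -> has_expansion g a -> unit_disk z -> f z = g z.
Proof. intros Hf Hg Hz. exact (is_series_C_unique _ _ _ (Hf z Hz) (Hg z Hz)). Qed.

(** Differentiating moves the coefficient of index [n + 1] to index [n], so
    each coefficient is eventually read off as a value at [0]. *)
Lemma has_expansion_zero_coef (f : C -> C) (a : nat -> C) :
  (forall z, unit_disk z -> f z = 0%C) -> has_expansion f a -> forall n, a n = 0%C.
Proof.
intros E H n. revert f a E H. induction n as [|n IH]; intros f a E H.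
- rewrite <- (has_expansion_at_0 f a H). apply E, unit_disk_0.
- assert (D : derive_coef a n = 0%C).
  { apply (IH (C_derive f)); [|now apply has_expansion_C_derive].
    intros z Hz. apply is_C_derive_unique.
    apply (is_derive_ext_disk (fun _ => RtoC 0)); auto.
    - intros w Hw. now rewrite E.
    - apply is_derive_C_const. }
  transitivity (/ INR (S n) * derive_coef a n)%C.
  + unfold derive_coef. field. apply INR_S_neq_0.
  + rewrite D. ring.
Qed.

(** Mertens' theorem for real series, applied to the four products of real and
    imaginary parts. *)
Lemma is_series_C_mult (s t : nat -> C) (ls lt : C) :
  is_series_C s ls -> is_series_C t lt ->
  ex_series (fun n => Cmod (s n)) -> ex_series (fun n => Cmod (t n)) ->
  is_series_C (fun n => sum_n (fun k => s k * t (n - k)%nat)%C n) (ls * lt)%C.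
Proof.
intros Hs Ht As At.
apply is_series_C_iff in Hs, Ht. destruct Hs as [s1 s2], Ht as [t1 t2].
assert (AR : forall u : nat -> C, ex_series (fun n => Cmod (u n)) ->
   ex_series (fun n => Rabs (Re (u n)))).
{ intros u. apply (ex_series_le (V := R_CompleteNormedModule)). intros n.
  change (Rabs (Rabs (Re (u n))) <= Cmod (u n)). rewrite Rabs_Rabsolu. apply re_le_Cmod. }
assert (AI : forall u : nat -> C, ex_series (fun n => Cmod (u n)) ->
   ex_series (fun n => Rabs (Im (u n)))).
{ intros u. apply (ex_series_le (V := R_CompleteNormedModule)). intros n.
  change (Rabs (Rabs (Im (u n))) <= Cmod (u n)). rewrite Rabs_Rabsolu. apply Im_le_Cmod. }
apply is_series_C_iff. split.
- generalize (is_series_minus _ _ _ _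
    (is_series_mult _ _ _ _ s1 t1 (AR _ As) (AR _ At))
    (is_series_mult _ _ _ _ s2 t2 (AI _ As) (AI _ At))).
  apply is_series_ext. intros n. rewrite Re_sum_n, sum_n_Reals.
  symmetry. exact (minus_sum _ _ n).
- generalize (is_series_plus _ _ _ _
    (is_series_mult _ _ _ _ s1 t2 (AR _ As) (AI _ At))
    (is_series_mult _ _ _ _ s2 t1 (AI _ As) (AR _ At))).
  apply is_series_ext. intros n. rewrite Im_sum_n, sum_n_Reals.
  symmetry. exact (plus_sum _ _ n).
Qed.

Definition conv (a b : nat -> C) (n : nat) : C :=
  sum_n (fun k => a k * b (n - k)%nat)%C n.

Lemma has_expansion_mult (f g : C -> C) (a b : nat -> C) :
  has_expansion f a -> has_expansion g b ->
  has_expansion (fun z => f z * g z)%C (conv a b).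
Proof.
intros Hf Hg z Hz. apply (proj2 (is_pseries_C_iff _ _ _)).
assert (A : forall h c, has_expansion h c -> ex_series (fun n => Cmod (z ^ n * c n))).
{ intros h c Hh. generalize (ex_series_subexponential c (Cmod z)
    (has_expansion_subexponential h c Hh) (conj (Cmod_ge_0 z) Hz)).
  apply ex_series_ext. intros n. rewrite Cmod_mult, Cmod_pow. exact (Rmult_comm _ _). }
generalize (is_series_C_mult _ _ _ _
  (proj1 (is_pseries_C_iff _ _ _) (Hf z Hz)) (proj1 (is_pseries_C_iff _ _ _) (Hg z Hz))
  (A f a Hf) (A g b Hg)).
apply is_series_ext. intros n. unfold conv.
rewrite <- (sum_n_mult_l (K := C_Ring)).
apply sum_n_ext_loc. intros k Hk.
change (@eq C (z ^ k * a k * (z ^ (n - k) * b (n - k)%nat))%C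
  (z ^ n * (a k * b (n - k)%nat))%C).
assert (E : (z ^ n = z ^ k * z ^ (n - k))%C).
{ rewrite <- Cpow_add_r. f_equal. lia. }
rewrite E. ring.
Qed.

(** * Functions with prescribed pre-Schwarzian derivative *)

Lemma finite_upper_bound (x : nat -> R) (N : nat) :
  exists M, 0 <= M /\ forall j, (j <= N)%nat -> x j <= M.
Proof.
induction N as [|N [M [HM IH]]].
- exists (Rmax 0 (x 0%nat)). split; [apply Rmax_l|].
  intros j Hj. replace j with 0%nat by lia. apply Rmax_r.
- exists (Rmax M (x (S N))). split; [eapply Rle_trans; [exact HM|apply Rmax_l]|].
  intros j Hj. destruct (Nat.eq_dec j (S N)) as [->|]; [apply Rmax_r|].
  eapply Rle_trans; [apply IH; lia|apply Rmax_l].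
Qed.

Lemma sum_n_le_limit (b : nat -> R) (l : R) (n : nat) :
  (forall k, 0 <= b k) -> is_series b l -> sum_n b n <= l.
Proof.
intros Hb Hl. apply (is_lim_seq_incr_compare (sum_n b) l Hl).
intros k. rewrite sum_Sn. change (sum_n b k <= sum_n b k + b (S k)).
specialize (Hb (S k)). lra.
Qed.

(** The equation [p' = beta p] with [p (0) = 1] determines the coefficients of
    [p] by [(n + 1) p_(n+1) = b_0 p_n + ... + b_n p_0]. The recursion is
    course-of-values: stage [n] is a sequence that is correct up to index
    [n]. *)
Fixpoint ode_table (b : nat -> C) (n : nat) : nat -> C :=
  match n with
  | O => fun _ => 1%C
  | S n' => fun m =>
      if Nat.leb m n' then ode_table b n' m
      else (conv b (ode_table b n') n' / INR (S n'))%C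
  end.

Definition ode_coef (b : nat -> C) (n : nat) : C := ode_table b n n.

Lemma ode_table_stable (b : nat -> C) (n m : nat) :
  (m <= n)%nat -> ode_table b n m = ode_coef b m.
Proof.
induction n as [|n IH]; intros Hm.
- now replace m with 0%nat by lia.
- destruct (Nat.eq_dec m (S n)) as [->|Hne]; [reflexivity|].
  simpl. rewrite (proj2 (Nat.leb_le m n)) by lia. apply IH; lia.
Qed.

Lemma derive_coef_ode (b : nat -> C) (n : nat) :
  derive_coef (ode_coef b) n = conv b (ode_coef b) n.
Proof.
unfold derive_coef, ode_coef at 1. cbn [ode_table].
rewrite (proj2 (Nat.leb_gt (S n) n)) by lia.
replace (conv b (ode_table b n) n) with (conv b (ode_coef b) n).
- field. apply INR_S_neq_0.
- apply sum_n_ext_loc. intros k Hk. rewrite ode_table_stable by lia. reflexivity.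
Qed.

(** Put [x_n = |p_n| r ^ n] and let [s] be the sum of [|b_k| r ^ k]. The
    recurrence gives [(n + 1) x_(n+1) <= s max (x_0, ..., x_n)], so from the
    index [n >= s] on the running maximum no longer grows. *)
Lemma subexponential_ode (b : nat -> C) :
  subexponential b -> subexponential (ode_coef b).
Proof.
intros Hb r Hr.
destruct (ex_series_subexponential b r Hb ltac:(lra)) as [s Hs].
set (x := fun n => Cmod (ode_coef b n) * r ^ n).
destruct (INR_unbounded s) as [N HN].
destruct (finite_upper_bound x N) as [M [HM HxM]].
exists M.
assert (Strong : forall n j, (j <= n)%nat -> x j <= M).
{ induction n as [|n IH]; intros j Hj; [apply HxM; lia|].
  destruct (Nat.le_gt_cases j N) as [|Hgt]; [now apply HxM|].
  destruct (Nat.eq_dec j (S n)) as [->|]; [|apply IH; lia].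
  pose proof (lt_0_INR (S n) ltac:(lia)) as Pn.
  assert (Conv : Cmod (conv b (ode_coef b) n) * r ^ n <= s * M).
  { assert (T : Cmod (conv b (ode_coef b) n)
        <= sum_f_R0 (fun k => Cmod (b k * ode_coef b (n - k)%nat)) n).
    { rewrite <- sum_n_Reals. apply (norm_sum_n_m (V := C_NormedModule)). }
    apply Rmult_le_compat_r with (r := r ^ n) in T; [|apply pow_le; lra].
    eapply Rle_trans; [exact T|].
    apply Rle_trans with (sum_f_R0 (fun k => Cmod (b k) * r ^ k * M) n).
    - rewrite Rmult_comm, scal_sum. apply sum_Rle. intros k Hk.
      rewrite Cmod_mult.
      replace (r ^ n) with (r ^ k * r ^ (n - k)) by (rewrite <- pow_add; f_equal; lia).
      replace (Cmod (b k) * Cmod (ode_coef b (n - k)) * (r ^ k * r ^ (n - k)))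
        with (Cmod (b k) * r ^ k * x (n - k)%nat) by (unfold x; ring).
      apply Rmult_le_compat_l; [|apply IH; lia].
      apply Rmult_le_pos; [apply Cmod_ge_0|apply pow_le; lra].
    - rewrite <- scal_sum, Rmult_comm, <- sum_n_Reals.
      apply Rmult_le_compat_r; [exact HM|].
      apply sum_n_le_limit; [|exact Hs].
      intros k. apply Rmult_le_pos; [apply Cmod_ge_0|apply pow_le; lra]. }
  rewrite <- derive_coef_ode in Conv. unfold derive_coef in Conv.
  rewrite Cmod_mult, Cmod_R, Rabs_right in Conv by lra.
  apply Rmult_le_reg_l with (INR (S n)); [exact Pn|].
  apply Rle_trans with (s * M).
  - unfold x. eapply Rle_trans; [|exact Conv]. simpl pow.
    assert (P : 0 <= INR (S n) * Cmod (ode_coef b (S n)) * r ^ n).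
    { repeat apply Rmult_le_pos; [lra|apply Cmod_ge_0|apply pow_le; lra]. }
    nra.
  - apply Rmult_le_compat_r; [exact HM|].
    assert (INR N <= INR (S n)) by (apply le_INR; lia). lra. }
intros n. exact (Strong n n (Nat.le_refl n)).
Qed.

Lemma exists_exp_primitive (beta : C -> C) (b : nat -> C) :
  has_expansion beta b ->
  exists p, has_expansion p (ode_coef b) /\
    forall z, unit_disk z -> is_derive p z (beta z * p z)%C.
Proof.
intros Hb.
destruct (subexponential_expansion (ode_coef b)) as [p Hp].
{ eapply subexponential_ode, has_expansion_subexponential, Hb. }
exists p; split; [exact Hp|]. intros z Hz.
apply (is_derive_expansion p (fun z => beta z * p z)%C (ode_coef b)); auto.
apply has_expansion_coef_ext with (conv b (ode_coef b)).
- intros n. now rewrite derive_coef_ode.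
- now apply has_expansion_mult.
Qed.

(** With [q] the solution for [- beta], the product [p q] has derivative [0]
    and hence the constant value [1]; this replaces the formula
    [p = exp (primitive of beta)]. *)
Lemma exp_primitive_neq_0 (beta p : C -> C) (b : nat -> C) (z : C) :
  has_expansion beta b -> has_expansion p (ode_coef b) ->
  (forall z, unit_disk z -> is_derive p z (beta z * p z)%C) ->
  unit_disk z -> p z <> 0%C.
Proof.
intros Hb Hp Dp Hz.
assert (Hb' : has_expansion (fun z => - beta z)%C (fun n => - b n)%C).
{ intros w Hw. exact (is_pseries_opp b w _ (Hb w Hw)). }
destruct (exists_exp_primitive _ _ Hb') as [q [Hq Dq]].
pose proof (has_expansion_mult _ _ _ _ Hp Hq) as Hpq.
set (c := conv _ _) in Hpq.
assert (Hc : forall n, derive_coef c n = 0%C).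
{ apply (has_expansion_zero_coef (C_derive (fun z => p z * q z)%C));
    [|now apply has_expansion_C_derive].
  intros w Hw. apply is_C_derive_unique.
  apply (is_derive_C_eq _ _ _ _ (is_derive_C_mult p q w _ _ (Dp w Hw) (Dq w Hw))).
  ring. }
assert (Hone : (p z * q z)%C = (p 0 * q 0)%C).
{ apply (is_series_C_unique (fun n => z ^ n * c n)%C).
  - apply (proj1 (is_pseries_C_iff _ _ _)). exact (Hpq z Hz).
  - (* Only the constant term survives, so the series at [z] and at [0] have
       the same terms. *)
    generalize (proj1 (is_pseries_C_iff _ _ _) (Hpq 0%C unit_disk_0)).
    apply is_series_ext. intros n.
    destruct n as [|n]; [reflexivity|].
    specialize (Hc n). unfold derive_coef in Hc.
    replace (c (S n)) with (RtoC 0); [apply injective_projections; simpl; ring|].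
    transitivity (/ INR (S n) * (INR (S n) * c (S n)))%C.
    + rewrite Hc. ring.
    + field. apply INR_S_neq_0. }
rewrite (has_expansion_at_0 p _ Hp), (has_expansion_at_0 q _ Hq) in Hone.
unfold ode_coef in Hone; cbn [ode_table] in Hone.
intros E. rewrite E in Hone. apply (f_equal Re) in Hone. simpl in Hone. lra.
Qed.

Definition primitive_coef (a : nat -> C) (n : nat) : C :=
  match n with O => 0%C | S m => (a m / INR (S m))%C end.

Lemma derive_primitive_coef (a : nat -> C) (n : nat) :
  derive_coef (primitive_coef a) n = a n.
Proof. unfold derive_coef; cbn [primitive_coef]. field. apply INR_S_neq_0. Qed.

Lemma subexponential_primitive (a : nat -> C) :
  subexponential a -> subexponential (primitive_coef a).
Proof.
intros Ha r Hr. destruct (Ha r Hr) as [M HM]. exists M.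
assert (HM0 : 0 <= M).
{ eapply Rle_trans; [|apply (HM 0%nat)].
  apply Rmult_le_pos; [apply Cmod_ge_0|apply pow_le; lra]. }
intros [|n]; cbn [primitive_coef].
- rewrite Cmod_0. lra.
- rewrite Cmod_div, Cmod_R, Rabs_right
    by (try apply INR_S_neq_0; apply Rle_ge, pos_INR).
  eapply Rle_trans; [|apply (HM n)].
  assert (P : 0 <= Cmod (a n)) by apply Cmod_ge_0.
  assert (Q : 0 <= r ^ n) by (apply pow_le; lra).
  assert (I : / INR (S n) <= 1).
  { rewrite <- Rinv_1. apply Rinv_le_contravar; [lra|].
    rewrite S_INR. pose proof (pos_INR n). lra. }
  assert (I0 : 0 <= / INR (S n)) by (apply Rlt_le, Rinv_0_lt_compat, lt_0_INR; lia).
  simpl pow. unfold Rdiv.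
  replace (Cmod (a n) * / INR (S n) * (r * r ^ n))
    with (Cmod (a n) * r ^ n * (/ INR (S n) * r)) by ring.
  rewrite <- (Rmult_1_r (Cmod (a n) * r ^ n)) at 2.
  apply Rmult_le_compat_l; [now apply Rmult_le_pos|]. nra.
Qed.

(** The derivative of [f] is the solution [p] of [p' = beta p], and [f] is its
    termwise primitive. *)
Lemma exists_pre_Schwarzian (beta : C -> C) (b : nat -> C) :
  has_expansion beta b ->
  exists f a, class_A f /\ has_expansion f a /\ a 2%nat = (b 0%nat / 2)%C /\
    forall z, unit_disk z ->
      C_derive f z <> 0%C /\
      (C_derive (C_derive f) z / C_derive f z)%C = beta z.
Proof.
intros Hb.
destruct (exists_exp_primitive beta b Hb) as [p [Hp Dp]].
destruct (subexponential_expansion (primitive_coef (ode_coef b))) as [f Hf].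
{ eapply subexponential_primitive, has_expansion_subexponential, Hp. }
destruct (has_expansion_C_derive _ _ Hf) as [Hf' Df].
apply has_expansion_coef_ext with (b := ode_coef b) in Hf'; [|apply derive_primitive_coef].
assert (E1 : forall z, unit_disk z -> C_derive f z = p z).
{ intros z Hz. exact (has_expansion_unique _ _ _ z Hf' Hp Hz). }
assert (E2 : forall z, unit_disk z -> C_derive (C_derive f) z = (beta z * p z)%C).
{ intros z Hz. apply is_C_derive_unique.
  apply (is_derive_ext_disk p); auto. intros w Hw. now rewrite E1. }
exists f, (primitive_coef (ode_coef b)). split; [|split; [exact Hf|split]].
- split; [|split].
  + intros z Hz. exists (C_derive f z). now apply Df.
  + now rewrite (has_expansion_at_0 f _ Hf).
  + apply (is_derive_C_eq _ _ _ _ (Df _ unit_disk_0)).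
    now rewrite E1, (has_expansion_at_0 p _ Hp) by apply unit_disk_0.
- pose proof (derive_coef_ode b 0) as E. unfold conv in E. rewrite sum_O in E.
  cbn [primitive_coef]. unfold derive_coef in E.
  replace (ode_coef b 1) with (b 0%nat * ode_coef b (0 - 0))%C.
  + unfold ode_coef; cbn [ode_table Nat.sub].
    replace (INR 2) with 2 by (simpl; ring).
    field.
  + rewrite <- E. simpl. ring.
- intros z Hz. pose proof (exp_primitive_neq_0 beta p b z Hb Hp Dp Hz) as Hnz.
  rewrite E1, E2 by exact Hz. split; [exact Hnz|]. now field.
Qed.

Lemma exists_difference_quotient (phi : C -> C) (B : nat -> C) :
  has_expansion phi B ->
  exists beta, has_expansion beta (fun n => B (S n)) /\
    forall z, unit_disk z -> phi z = (phi 0 + z * beta z)%C.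
Proof.
intros HB.
destruct (subexponential_expansion (fun n => B (S n))) as [beta Hbeta].
{ eapply subexponential_shift, has_expansion_subexponential, HB. }
exists beta; split; [exact Hbeta|]. intros z Hz.
rewrite (has_expansion_at_0 phi B HB).
apply (is_series_C_unique (fun n => z ^ n * B n)%C).
- apply (proj1 (is_pseries_C_iff _ _ _)). exact (HB z Hz).
- apply (is_series_decr_1 (V := C_NormedModule)).
  generalize (is_series_scal (V := C_NormedModule) z _ _
    (proj1 (is_pseries_C_iff _ _ _) (Hbeta z Hz))).
  match goal with |- is_series _ ?x -> is_series _ ?y => replace y with x end.
  + apply is_series_ext. intros n.
    change (@eq C (z * (z ^ n * B (S n)))%C (z ^ S n * B (S n))%C).
    rewrite Cpow_S. ring.
  + change (@eq C (z * beta z)%C (B 0%nat + z * beta z - 1 * B 0%nat)%C). ring.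
Qed.

(** * The second coefficient and the determinants *)

(** Both sides are the derivative at [0] of [1 + z f'' / f' = phi o omega]:
    the left one because [f'' (0) = 2 a_2] and [f' (0) = 1], the right one by
    the chain rule, with [c = omega' (0)] bounded by the Schwarz lemma. *)
Lemma class_C_a2 (phi f : C -> C) (a : nat -> C) (b : C) :
  class_C phi f -> has_expansion f a -> is_derive phi (RtoC 0) b ->
  exists c, Cmod c <= 1 /\ (2 * a 2%nat)%C = (b * c)%C.
Proof.
intros [[_ [_ Hf1]] [Hnz [omega [Hom [Hdisk [Hom0 Hsub]]]]]] Hf Hb.
destruct (Hom _ unit_disk_0) as [c Hc].
exists c. split; [now apply (Schwarz_derive omega)|].
destruct (has_expansion_C_derive _ _ Hf) as [Hf' _].
destruct (has_expansion_C_derive _ _ Hf') as [Hf'' Df'].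
destruct (has_expansion_C_derive _ _ Hf'') as [_ Df''].
assert (V1 : C_derive f 0 = 1%C) by now apply is_C_derive_unique.
assert (V2 : C_derive (C_derive f) 0 = (2 * a 2%nat)%C).
{ rewrite (has_expansion_at_0 _ _ Hf''). unfold derive_coef.
  replace (INR 2) with 2 by (simpl; ring). simpl. ring. }
rewrite <- V2.
rewrite <- (is_C_derive_unique _ _ _ (is_derive_C_comp phi omega 0%C b c
   (eq_ind_r (fun w => is_derive phi w b) Hb Hom0) Hc)).
symmetry. apply is_C_derive_unique.
apply (is_derive_ext_disk _ _ _ _ Hsub unit_disk_0).
eapply is_derive_C_eq.
- apply (is_derive_C_plus (fun _ => 1%C)); [apply is_derive_C_const|].
  apply (is_derive_C_mult (fun z => z * C_derive (C_derive f) z)%C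
    (fun z => / C_derive f z)%C).
  + apply (is_derive_C_mult (fun z => z)); [apply is_derive_C_id|].
    apply Df'', unit_disk_0.
  + apply (is_derive_C_comp Cinv (C_derive f)).
    * apply is_derive_C_inv, Hnz, unit_disk_0.
    * apply Df', unit_disk_0.
- rewrite V1. field.
Qed.

(** The determinant equals [1 + |a_2| ^ 4 - 2 |a_2| ^ 2 - |a_3 - a_2 ^ 2| ^ 2],
    and [|a_2| ^ 4 <= |a_2| ^ 2]. *)
Lemma det_T31_le_1 (a : nat -> C) : Cmod (a 2%nat) <= 1 -> det_T31 a <= 1.
Proof.
intros H. unfold det_T31.
pose proof (Rle_trans _ _ _ (Rle_abs _)
  (re_le_Cmod (a 2%nat * a 2%nat * Cconj (a 3%nat))%C)) as T.
rewrite !Cmod_mult, Cmod_conj in T.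
pose proof (Cmod_ge_0 (a 2%nat)) as P.
set (m := Cmod (a 2%nat)) in *. set (s := Cmod (a 3%nat)) in *.
assert (Q : m * m * (m * m) <= 2 * (m * m)).
{ apply Rmult_le_compat_r; nra. }
pose proof (Rle_0_sqr (m * m - s)) as Sq. unfold Rsqr in Sq. nra.
Qed.

Definition id_coef (n : nat) : C := match n with 1%nat => 1%C | _ => 0%C end.

Lemma id_expansion : has_expansion (fun z => z) id_coef.
Proof.
intros z _. apply (proj2 (is_pseries_C_iff _ _ _)).
apply (is_series_decr_1 (V := C_NormedModule)).
apply (filterlim_ext (fun _ => z)).
- intros n. induction n as [|n IH].
  + rewrite sum_O. change (@eq C z (z * 1 * 1)%C). ring.
  + rewrite sum_Sn, <- IH.
    change (@eq C z (z + (z ^ S (S n)) * 0)%C). ring.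
- match goal with |- filterlim _ _ (locally ?y) => replace y with z end.
  + apply filterlim_const.
  + change (@eq C z (z - 1 * 0)%C). ring.
Qed.

Lemma id_class_C (phi : C -> C) : phi 0%C = 1%C -> class_C phi (fun z => z).
Proof.
intros H0.
assert (D1 : forall z, C_derive (fun z => z) z = 1%C).
{ intros z. apply is_C_derive_unique, is_derive_C_id. }
assert (D2 : forall z, C_derive (C_derive (fun z => z)) z = 0%C).
{ intros z. apply is_C_derive_unique.
  apply (is_derive_ext (fun _ => RtoC 1)); [|apply is_derive_C_const].
  intros w. now rewrite D1. }
split; [|split].
- split; [|split].
  + intros z _. eexists. apply is_derive_C_id.
  + reflexivity.
  + apply is_derive_C_id.
- intros z _ E. rewrite D1 in E. apply RtoC_inj in E. lra.
- exists (fun _ => 0%C). split; [|split; [|split]].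
  + intros z _. eexists. apply is_derive_C_const.
  + intros z _. exact unit_disk_0.
  + reflexivity.
  + intros z _. rewrite D1, D2, H0. field.
Qed.

Theorem theorem3 (phi : C -> C) (B : nat -> C)
    (hphi : Ma_Minda phi) (hB : has_expansion phi B) :
  ((forall (f : C -> C) (a : nat -> C),
      class_C phi f -> has_expansion f a ->
      1 - Re (B 1%nat) ^ 2 / 4 <= det_T21 a <= 1) /\
   (exists (f : C -> C) (a : nat -> C),
      class_C phi f /\ has_expansion f a /\
      det_T21 a = 1 - Re (B 1%nat) ^ 2 / 4) /\
   (exists (f : C -> C) (a : nat -> C),
      class_C phi f /\ has_expansion f a /\ det_T21 a = 1)) /\
  (Re (B 1%nat) <= Cmod (B 2%nat + B 1%nat * B 1%nat)%C ->
   (forall (f : C -> C) (a : nat -> C),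
      class_C phi f -> has_expansion f a -> det_T31 a <= 1) /\
   (exists (f : C -> C) (a : nat -> C),
      class_C phi f /\ has_expansion f a /\ det_T31 a = 1)).
Proof.
destruct hphi as [Han [_ [Hre [H0 [[b [Hb Db]] _]]]]].
assert (EB : B 1%nat = RtoC b).
{ destruct (has_expansion_C_derive _ _ hB) as [HD _].
  rewrite <- (is_C_derive_unique _ _ _ Db), (has_expansion_at_0 _ _ HD).
  unfold derive_coef. simpl. ring. }
assert (Hb2 : b <= 2).
{ pose proof (Caratheodory_derive phi b Han Hre H0 Db) as K.
  now rewrite Cmod_R, Rabs_right in K by lra. }
assert (Ha2 : forall f a, class_C phi f -> has_expansion f a ->
   Cmod (a 2%nat) <= b / 2).
{ intros f a Hf Ha. destruct (class_C_a2 phi f a b Hf Ha Db) as [c [Hc E]].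
  apply (f_equal Cmod) in E. rewrite !Cmod_mult, !Cmod_R, !Rabs_right in E by lra.
  nra. }
rewrite EB. change (Re (RtoC b)) with b.
split; [split; [|split]|intros _; split].
- intros f a Hf Ha. specialize (Ha2 f a Hf Ha).
  pose proof (Cmod_ge_0 (a 2%nat)). unfold det_T21. nra.
- destruct (exists_difference_quotient phi B hB) as [beta [Hbeta Hphi]].
  destruct (exists_pre_Schwarzian beta _ Hbeta) as [f [a [HA [Ha [E2 Hf]]]]].
  exists f, a. split; [|split; [exact Ha|]].
  + split; [exact HA|split].
    * intros z Hz. now apply Hf.
    * exists (fun z => z). split; [|split; [|split]].
      -- intros z _. eexists. apply is_derive_C_id.
      -- auto.
      -- reflexivity.
      -- intros z Hz. rewrite (Hphi z Hz), H0, <- (proj2 (Hf z Hz)).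
         unfold Cdiv. ring.
  + unfold det_T21. rewrite E2, EB, Cmod_div, !Cmod_R, !Rabs_right
      by (try lra; intros E; apply RtoC_inj in E; lra). field.
- exists (fun z => z), id_coef. split; [now apply id_class_C|split; [exact id_expansion|]].
  unfold det_T21. simpl. rewrite Cmod_0. ring.
- intros f a Hf Ha. apply det_T31_le_1. specialize (Ha2 f a Hf Ha). lra.
- exists (fun z => z), id_coef. split; [now apply id_class_C|split; [exact id_expansion|]].
  unfold det_T31. simpl. rewrite Cmod_0. ring.
Qed.
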